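(* Let $\Pi$ be a graph class on which \textsc{Hamiltonian Cycle} is NP-hard. Then \textsc{Unweighted Connectivity NWS} is NP-complete on input graphs from $\Pi$, even if $t=1$.
   Context: An instance of \textsc{Connectivity NWS} consists of a graph $G$, a collection $\mathcal{C}$ of subsets of $V(G)$ (communities), an edge-weight function $\omega: E(G)\to \mathbb{R}_+$, an integer $\ell$, and a positive real $b$; the question is whether there is a spanning subgraph $G'=(V(G),E')$ with $E'\subseteq E(G)$, $|E'|\le\ell$, $\omega(E')\le b$, such that $G'[C]$ is connected for every $C\in\mathcal{C}$. \textsc{Unweighted Connectivity NWS} is the special case with all edge weights equal to $1$. The parameter $t$ is $\ell-n+x$, where $n=|V(G)|$ and $x$ is the number of connected components of the hypergraph $(V(G),\mathcal{C})$ (the feedback edge number of a solution). \textsc{Hamiltonian Cycle} asks whether a graph contains a cycle through every vertex exactly once. *)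

(* Defs.v *)
From HB Require Import structures.
From Corelib Require Import BinNums.
From mathcomp Require Import all_boot all_order all_algebra.

Set Implicit Arguments.
Unset Strict Implicit.
Unset Printing Implicit Defensive.

Import Order.TTheory GRing.Theory Num.Theory.

Definition bits := seq bool.

(* [None] is the blank. *)
Definition symbol := option bool.

(* [None] is "stay", [Some false] is "left" and [Some true] is "right". *)
Definition direction := option bool.

(* [(l, r)] is a two-way infinite tape: [r] starts at the scanned cell, [l]
   lists the cells to its left, nearest first; all cells beyond are blank. *)
Definition tape : Type := seq symbol * seq symbol.

Definition tape_read (tp : tape) : symbol := head None tp.2.

Definition tape_write (s : symbol) (tp : tape) : tape :=
  (tp.1, s :: behead tp.2).

Definition tape_move (d : direction) (tp : tape) : tape :=
  match d with
  | None => tp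
  | Some false => (behead tp.1, head None tp.1 :: tp.2)
  | Some true => (head None tp.2 :: tp.1, behead tp.2)
  end.

Definition tape_input (x : bits) : tape := ([::], map Some x).

(* The word that starts at the scanned cell and ends before the first blank. *)
Definition tape_output (tp : tape) : bits :=
  pmap id (take (index None tp.2) tp.2).

(* A deterministic multi-tape machine with [extra_tapes.+1] tapes; the
   first one holds the input and the last one the output (they coincide when there is a single tape). *)
Record turing_machine := TuringMachine {
  extra_tapes : nat;
  state : finType;
  start : state;
  halting : pred state;
  transition : state -> {ffun 'I_extra_tapes.+1 -> symbol} ->
    state * {ffun 'I_extra_tapes.+1 -> symbol * direction}
}.

Definition config (M : turing_machine) : Type :=
  state M * {ffun 'I_(extra_tapes M).+1 -> tape}.

Definition tm_init (M : turing_machine) (x : bits) : config M :=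
  (start M, [ffun i => tape_input (if i == ord0 then x else [::])]).

Definition tm_step (M : turing_machine) (c : config M) : config M :=
  if halting c.1 then c else
  let a := transition c.1 [ffun i => tape_read (c.2 i)] in
  (a.1, [ffun i => tape_move (a.2 i).2 (tape_write (a.2 i).1 (c.2 i))]).

Definition computes_within (M : turing_machine) (x y : bits) (t : nat) : Prop :=
  let c := iter t (@tm_step M) (tm_init M x) in
  halting c.1 /\ tape_output (c.2 ord_max) = y.

Definition polytime (f : bits -> bits) : Prop :=
  exists (M : turing_machine) (p : {poly nat}),
    forall x, computes_within M x (f x) p.[size x]%R.

(* A self-delimiting code: each bit is preceded by [true], and each word is
   terminated by [false]. *)
Definition enc_word (w : bits) : bits :=
  flatten [seq [:: true; b] | b <- w] ++ [:: false].

Definition enc_seq (ws : seq bits) : bits := flatten (map enc_word ws).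

(* Binary notation, least significant bit first; 0 is the empty word. *)
Fixpoint enc_pos (p : positive) : bits :=
  match p with
  | xH => [:: true]
  | xO q => false :: enc_pos q
  | xI q => true :: enc_pos q
  end.

Definition enc_nat (n : nat) : bits :=
  if bin_of_nat n is Npos p then enc_pos p else [::].

Definition enc_int (z : int) : bits := (z < 0)%R :: enc_nat `|z|%N.

Definition enc_rat (q : rat) : bits :=
  enc_seq [:: enc_int (numq q); enc_int (denq q)].

(* A decision problem with instances restricted to [valid] ones. [valid] acts
   as a promise, as usual for problems restricted to a class of inputs: it is
   not required to be recognizable in polynomial time. *)
Record problem := Problem {
  instance : Type;
  encode : instance -> bits;
  valid : instance -> Prop;
  yes : instance -> Prop
}.

Definition restrict (P : problem) (D : instance P -> Prop) : problem :=
  Problem (@encode P) (fun I => valid I /\ D I) (@yes P).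

Definition language (L : bits -> Prop) : problem :=
  Problem id (fun _ => True) L.

Definition in_NP (P : problem) : Prop :=
  exists (V : bits -> bits) (p : {poly nat}),
    polytime V /\
    forall I : instance P, valid I ->
      (yes I <-> exists u : bits,
         (size u <= p.[size (encode I)]%R)%N /\
         V (enc_seq [:: encode I; u]) = [:: true]).

Definition NP_hard (P : problem) : Prop :=
  forall L : bits -> Prop, in_NP (language L) ->
    exists f : bits -> instance P,
      polytime (fun x => encode (f x)) /\
      forall x, valid (f x) /\ (L x <-> yes (f x)).

Definition NP_complete (P : problem) : Prop := in_NP P /\ NP_hard P.

Record graph := Graph {
  order : nat;
  edges : {set {set 'I_order}};
  card_edge : forall e, e \in edges -> #|e| = 2
}.

Notation vertex G := 'I_(order G).

Definition adj (T : finType) (E : {set {set T}}) : rel T :=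
  fun x y => [set x; y] \in E.

Definition induced_adj (T : finType) (E : {set {set T}}) (C : {set T}) : rel T :=
  fun x y => [&& x \in C, y \in C & adj E x y].

(* Connectedness of the subgraph of [(T, E)] induced by [C]; the graph without
   vertices is not connected. *)
Definition induced_connected (T : finType) (E : {set {set T}}) (C : {set T}) :
    Prop :=
  C != set0 /\ {in C &, forall x y, connect (induced_adj E C) x y}.

Definition enc_set (n : nat) (A : {set 'I_n}) : bits :=
  [seq i \in A | i <- enum 'I_n].

(* The adjacency matrix, row by row. *)
Definition enc_graph (G : graph) : bits :=
  enc_seq [seq [seq adj (edges G) i j | j <- enum (vertex G)]
          | i <- enum (vertex G)].

Definition graph_class := graph -> Prop.

Definition is_hamiltonian_cycle (G : graph) (s : seq (vertex G)) : Prop :=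
  [/\ 2 < size s, ucycle (adj (edges G)) s & forall x, x \in s].

Definition hamiltonian_cycle : problem :=
  Problem enc_graph (fun _ => True)
    (fun G => exists s : seq (vertex G), is_hamiltonian_cycle s).

(* Only the values of the weight function [w] on the edges of [G] matter. *)
Definition connectivity_nws_solution (R : numDomainType) (G : graph)
    (Cs : seq {set vertex G}) (w : {set vertex G} -> R) (l : int) (b : R)
    (E' : {set {set vertex G}}) : Prop :=
  [/\ E' \subset edges G,
      (#|E'|%:Z <= l)%R,
      (\sum_(e in E') w e <= b)%R &
      forall C, C \in Cs -> induced_connected E' C].

(* Instances with unit weights. The budget is rational so that instances have
   finite encodings. *)
Record unweighted_nws_instance := UnweightedNWS {
  nws_graph : graph;
  communities : seq {set vertex nws_graph};
  edge_bound : int;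
  budget : rat
}.

Definition enc_unweighted_nws (I : unweighted_nws_instance) : bits :=
  enc_seq [:: enc_graph (nws_graph I);
              enc_seq [seq enc_set C | C <- communities I];
              enc_int (edge_bound I);
              enc_rat (budget I)].

Definition unweighted_connectivity_nws : problem :=
  Problem enc_unweighted_nws (fun I => (0 < budget I)%R)
    (fun I => exists E', connectivity_nws_solution
       (communities I) (fun _ => 1%R) (edge_bound I) (budget I) E').

(* Two vertices are adjacent if they share a hyperedge; vertices that lie in no
   hyperedge are components of their own. *)
Definition hypergraph_components (T : finType) (Cs : seq {set T}) : nat :=
  n_comp (fun x y => has (fun C : {set T} => (x \in C) && (y \in C)) Cs) T.

Definition nws_t (I : unweighted_nws_instance) : int :=
  (edge_bound I - (order (nws_graph I))%:Z
   + (hypergraph_components (communities I))%:Z)%R.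

(* Main.v *)
Require Import Defs.
From HB Require Import structures.
From Corelib Require Import BinNums PosDef.
From mathcomp Require Import all_boot all_order all_algebra.
From mathcomp Require Import zify.

(** Hardness: for a graph on n >= 3 vertices take as communities the complements
    of the single vertices, and allow n edges; the communities form a connected
    hypergraph, so t = 1. A Hamiltonian cycle is a solution. Conversely, a
    solution stays connected after the deletion of any vertex, so every degree
    is at least 2; as there are at most n edges, every degree is exactly 2, and
    a connected 2-regular graph is a cycle. Graphs on fewer vertices are mapped
    to an instance whose only community is empty, which has no solution.

    Membership: the certificate is a 0/1 matrix selecting edges. Connectivity of
    each community is checked by n rounds of breadth-first search from some
    root.

    Polynomial time: values are binary trees, written as self-delimiting prefix
    codes on a stack; a program for a function replaces the code on top of the
    stack, so that composition is sequencing. Programs use four stacks and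
    compile to four-tape machines. The functions so computed are closed under
    pairing, case distinction and folds with polynomially bounded accumulators,
    so the verifier and the reduction are ordinary functions on lists. *)

Set Implicit Arguments.
Unset Strict Implicit.
Unset Printing Implicit Defensive.

Import Order.TTheory GRing.Theory Num.Theory.

(** * Stack programs and their compilation *)

(** The hypothesis yields its reduction to Hamiltonian Cycle only as some Turing machine, with any
    number of tapes. The new reduction therefore has to be composed with it at the level of
    machines; stack programs serve only for the functions written here. The instance keeps the graph
    itself unchanged, which is why it stays in the arbitrary class [Pi].

    A second obstacle is the size of numbers. Loops count in unary, but the edge bound and the
    budget are given in binary and may be exponentially large. They are never converted to unary:
    they are compared bit by bit with the number of chosen edges, and the running difference is
    capped at that number. *)

Inductive reg := RU | RS | RT | RN.

Record store := Store { su : bits; ss : bits; st : bits; sn : bits }.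

Definition get (r : reg) (m : store) : bits :=
  match r with RU => su m | RS => ss m | RT => st m | RN => sn m end.

Definition upd (r : reg) (w : bits) (m : store) : store :=
  match r with
  | RU => Store w (ss m) (st m) (sn m)
  | RS => Store (su m) w (st m) (sn m)
  | RT => Store (su m) (ss m) w (sn m)
  | RN => Store (su m) (ss m) (st m) w
  end.

Definition top (w : bits) : symbol := head None (map Some w).

Inductive prog :=
| Skip
| Push (r : reg) (b : bool)
| Pop (r : reg)
| Seq (p q : prog)
| If (r : reg) (c : symbol -> bool) (p q : prog)
| While (r : reg) (c : symbol -> bool) (p : prog).

(** The last index is the exact number of machine steps: a push takes two (move left, then write), a
    jump one. Sums are ordered so that [iterD] splits them in the order of execution. *)
Inductive exec : prog -> store -> store -> nat -> Prop :=
| ExSkip m : exec Skip m m 0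
| ExPush r b m : exec (Push r b) m (upd r (b :: get r m) m) 2
| ExPop r m : exec (Pop r) m (upd r (behead (get r m)) m) 1
| ExSeq p q m1 m2 m3 t1 t2 :
    exec p m1 m2 t1 -> exec q m2 m3 t2 -> exec (Seq p q) m1 m3 (t2 + t1)
| ExIfT r (c : symbol -> bool) p q m m' t :
    c (top (get r m)) -> exec p m m' t -> exec (If r c p q) m m' (1 + (t + 1))
| ExIfF r (c : symbol -> bool) p q m m' t :
    ~~ c (top (get r m)) -> exec q m m' t -> exec (If r c p q) m m' (t + 1)
| ExWhileT r (c : symbol -> bool) p m m' m'' t t' :
    c (top (get r m)) -> exec p m m' t -> exec (While r c p) m' m'' t' ->
    exec (While r c p) m m'' (t' + (1 + (t + 1)))
| ExWhileF r (c : symbol -> bool) p m :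
    ~~ c (top (get r m)) -> exec (While r c p) m m 1.

(* An instruction works on one tape; the last component is the address of the
   next instruction. *)
Definition instr : Type := reg * (symbol -> symbol * direction * nat).

Definition jump (r : reg) (f : symbol -> nat) : instr :=
  (r, fun s => (s, None, f s)).

Fixpoint len (p : prog) : nat :=
  match p with
  | Skip => 0
  | Push _ _ => 2
  | Pop _ => 1
  | Seq p q => len p + len q
  | If _ _ p q => (len p + (len q).+1).+1
  | While _ _ p => (len p + 1).+1
  end.

(** Jump targets are absolute, hence the start address [a]; control always leaves at address
    [a + len p]. *)
Fixpoint compile (a : nat) (p : prog) : seq instr :=
  match p with
  | Skip => [::]
  | Push r b => [:: (r, fun s => (s, Some false, a.+1));
                    (r, fun _ => (Some b, None, a.+2))]
  | Pop r => [:: (r, fun _ => (None, Some true, a.+1))]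
  | Seq p q => compile a p ++ compile (a + len p) q
  | If r c p q =>
      jump r (fun s => if c s then a.+1 else (a.+1 + len p).+1) ::
      compile a.+1 p ++
      jump r (fun _ => (a.+1 + len p).+1 + len q) ::
      compile (a.+1 + len p).+1 q
  | While r c p =>
      jump r (fun s => if c s then a.+1 else (a.+1 + len p).+1) ::
      compile a.+1 p ++ [:: jump r (fun _ => a)]
  end.

Lemma size_compile p a : size (compile a p) = len p.
Proof.
elim: p a => //= [p IHp q IHq|r c p IHp q IHq|r c p IHp] a;
  by rewrite ?size_cat /= ?size_cat /= ?IHp ?IHq.
Qed.

(** The order matters: [RU] is the input tape and [RN] the last one, which is the output tape. The
    stack of codes lives on [RS]. *)
Definition idx (r : reg) : 'I_4 :=
  match r with
  | RU => @Ordinal 4 0 isT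
  | RS => @Ordinal 4 1 isT
  | RT => @Ordinal 4 2 isT
  | RN => @Ordinal 4 3 isT
  end.

Definition halt_instr : instr := jump RU (fun _ => 0).

Definition code_tm (C : seq instr) : turing_machine :=
  @TuringMachine 3 'I_(size C).+1 ord0 (pred1 ord_max)
    (fun q rd =>
       let i := nth halt_instr C q in
       let a := i.2 (rd (idx i.1)) in
       (inord a.2, [ffun j => if j == idx i.1 then a.1 else (rd j, None)])).

(** The effect of a step on a tape that its instruction does not address: writing the scanned symbol
    back may turn an empty list into an explicit blank. *)
Definition touch (tp : tape) : tape := tape_write (tape_read tp) tp.

Lemma code_tm_step C q r f s d q' (tps : {ffun 'I_4 -> tape}) :
  (q < size C)%N -> nth halt_instr C q = (r, f) ->
  f (tape_read (tps (idx r))) = (s, d, q') ->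
  @tm_step (code_tm C) (inord q, tps) =
    (inord q', [ffun i => if i == idx r then tape_move d (tape_write s (tps i))
                          else touch (tps i)]).
Proof.
move=> ltq eC ef.
have vq : nat_of_ord (inord q : 'I_(size C).+1) = q by rewrite inordK // ltnW.
rewrite /tm_step /=.
case: eqP => [/(congr1 (@nat_of_ord _)) /=|_]; first by rewrite vq; lia.
rewrite vq eC /= ffunE ef /=; congr pair; apply/ffunP => i; rewrite !ffunE.
by case: ifP => // _; rewrite /touch ffunE.
Qed.

(** The top of the stack is the scanned cell. Explicit blanks after the word are tolerated because
    of [touch], and the cells to the left are unconstrained because a push overwrites the cell it
    moves onto. *)
Definition stack_rep (w : bits) (tp : tape) : Prop :=
  exists k, tp.2 = map Some w ++ nseq k None.

Definition rep (m : store) (tps : {ffun 'I_4 -> tape}) : Prop :=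
  forall r, stack_rep (get r m) (tps (idx r)).

Lemma stack_rep_read w tp : stack_rep w tp -> tape_read tp = top w.
Proof. by case=> k; rewrite /tape_read => ->; case: w => //=; case: k. Qed.

Lemma stack_rep_touch w tp : stack_rep w tp -> stack_rep w (touch tp).
Proof.
case=> k; rewrite /touch /tape_read /tape_write /stack_rep /= => ->.
case: w => [|b w] /=; last by exists k.
by case: k => [|k] /=; [exists 1 | exists k.+1].
Qed.

Lemma stack_rep_push w tp b :
  stack_rep w tp -> stack_rep (b :: w)
    (tape_write (Some b) (tape_move (Some false) (touch tp))).
Proof.
move/stack_rep_touch; case: (touch tp) => l r [k /= e].
by exists k; rewrite /= e.
Qed.

Lemma stack_rep_pop w tp :
  stack_rep w tp ->
  stack_rep (behead w) (tape_move (Some true) (tape_write None tp)).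
Proof.
case=> k; rewrite /stack_rep /= => ->.
by case: w => [|b w] /=; [case: k => [|k]; [exists 0|exists k] | exists k].
Qed.

Lemma eq_idx r r' : (idx r == idx r') -> r = r'.
Proof. by case: r r' => [] []. Qed.

Lemma get_upd r r' w m :
  get r (upd r' w m) = if idx r == idx r' then w else get r m.
Proof. by case: r r' => [] []. Qed.

Definition code_at (C : seq instr) (a : nat) (p : prog) : Prop :=
  exists pre post, C = pre ++ compile a p ++ post /\ size pre = a.

Lemma rep_touch_upd m r w (tps : {ffun 'I_4 -> tape}) (g : tape -> tape) :
  rep m tps -> stack_rep w (g (tps (idx r))) ->
  rep (upd r w m) [ffun i => if i == idx r then g (tps i) else touch (tps i)].
Proof.
move=> rp rg r'; rewrite ffunE get_upd.
by case: ifP => [/eq_idx ->//|_]; apply: stack_rep_touch.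
Qed.

Lemma upd_get r m : upd r (get r m) m = m.
Proof. by case: r m => [] []. Qed.

Lemma code_tm_jump C a r f m tps :
  (a < size C)%N -> nth halt_instr C a = jump r f -> rep m tps ->
  exists2 tps', rep m tps' &
    @tm_step (code_tm C) (inord a, tps) = (inord (f (top (get r m))), tps').
Proof.
move=> lta eC rp; eexists; last first.
  by apply: (code_tm_step lta eC); rewrite (stack_rep_read (rp r)).
rewrite -{1}(upd_get r m).
apply: (rep_touch_upd
  (g := fun tp => tape_move None (tape_write (top (get r m)) tp))) => //.
by rewrite -(stack_rep_read (rp r)); apply: stack_rep_touch.
Qed.

(** The induction is on the execution, not on the program, since a loop repeats its body. *)
Lemma exec_sim p m m' t : exec p m m' t ->
  forall C a tps, code_at C a p -> rep m tps ->
  exists2 tps', rep m' tps' &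
    iter t (@tm_step (code_tm C)) (inord a, tps) = (inord (a + len p), tps').
Proof.
elim=> {p m m' t}.
- by move=> m C a tps _ rp; exists tps; rewrite ?addn0.
- move=> r b m C a tps [pre [post [eC sp]]] rp.
  have lt : (a.+1 < size C)%N by rewrite eC !size_cat sp /=; lia.
  have e1 : nth halt_instr C a = (r, fun s => (s, Some false, a.+1)).
    by rewrite eC nth_cat sp ltnn subnn.
  have e2 : nth halt_instr C a.+1 = (r, fun _ => (Some b, None, a.+2)).
    by rewrite eC nth_cat sp ltnNge leqnSn subSnn.
  eexists; last first.
    rewrite /= (code_tm_step (ltnW lt) e1 erefl) (code_tm_step lt e2 erefl).
    by rewrite addn2; reflexivity.
  move=> r'; rewrite !ffunE get_upd.
  case: ifP => [/eq_idx ->|_]; first exact: stack_rep_push.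
  by do 2!apply: stack_rep_touch.
- move=> r m C a tps [pre [post [eC sp]]] rp.
  have lt : (a < size C)%N by rewrite eC !size_cat sp /=; lia.
  have e1 : nth halt_instr C a = (r, fun s => (None, Some true, a.+1)).
    by rewrite eC nth_cat sp ltnn subnn.
  eexists; last by rewrite /= (code_tm_step lt e1 erefl) addn1; reflexivity.
  by apply: (rep_touch_upd (g := fun tp =>
    tape_move (Some true) (tape_write None tp))) => //; apply: stack_rep_pop.
- move=> p q m1 m2 m3 t1 t2 _ IHp _ IHq C a tps [pre [post [/= eC sp]]] rp.
  have [|tps2 rp2 e2] := IHp C a tps _ rp.
    by exists pre, (compile (a + len p) q ++ post); rewrite eC -catA.
  have [|tps3 rp3 e3] := IHq C (a + len p) tps2 _ rp2.
    exists (pre ++ compile a p), post; rewrite eC -!catA.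
    by rewrite size_cat size_compile sp.
  by exists tps3 => //; rewrite iterD e2 e3 addnA.
- move=> r c p q m m' t hc _ IHp C a tps [pre [post [/= eC sp]]] rp.
  have lt : (a + (len p).+1 < size C)%N.
    by rewrite eC; do 3!rewrite ?(size_cat, size_compile, sp) /=; lia.
  have [||tps1 rp1 e1] := @code_tm_jump C a r
    (fun s => if c s then a.+1 else (a.+1 + len p).+1) m tps _ _ rp.
    by lia.
    by rewrite eC nth_cat sp ltnn subnn /=.
  have [|tps2 rp2 e2] := IHp C a.+1 tps1 _ rp1.
    exists (rcons pre (jump r (fun s => if c s then a.+1 else (a.+1 + len p).+1))).
    eexists; rewrite size_rcons sp; split=> //.
    by rewrite eC cat_rcons -catA.
  have [||tps3 rp3 e3] := @code_tm_jump C (a.+1 + len p) r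
    (fun _ => (a.+1 + len p).+1 + len q) m' tps2 _ _ rp2.
    by lia.
    rewrite eC nth_cat sp ifN; last by lia.
    have -> : (a.+1 + len p - a = (len p).+1)%N by lia.
    rewrite /= nth_cat nth_cat size_compile ltnn subnn /= size_cat size_compile.
    by rewrite /= ifT //; lia.
  exists tps3 => //; rewrite iterD iterD [iter 1 _ (_, tps)]/= e1 hc e2 /= e3.
  by congr (inord _, _); lia.
- move=> r c p q m m' t hc _ IHq C a tps [pre [post [/= eC sp]]] rp.
  have [||tps1 rp1 e1] := @code_tm_jump C a r
    (fun s => if c s then a.+1 else (a.+1 + len p).+1) m tps _ _ rp.
  + by rewrite eC; do 3!rewrite ?(size_cat, size_compile, sp) /=; lia.
  + by rewrite eC nth_cat sp ltnn subnn /=.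
  have [|tps2 rp2 e2] := IHq C (a.+1 + len p).+1 tps1 _ rp1.
    exists (pre ++ jump r (fun s => if c s then a.+1 else (a.+1 + len p).+1) ::
       rcons (compile a.+1 p) (jump r (fun _ => (a.+1 + len p).+1 + len q))).
    eexists; rewrite size_cat /= size_rcons size_compile sp; split; last by lia.
    by rewrite eC -!catA /= cat_rcons -?catA.
  exists tps2 => //; rewrite iterD [iter 1 _ _]/= e1 (negbTE hc) e2.
  by congr (inord _, _); lia.
- move=> r c p m m' m'' t t' hc _ IHp _ IHw C a tps hC rp.
  have [pre [post [/= eC sp]]] := hC.
  have lt : (a + (len p).+1 < size C)%N.
    by rewrite eC; do 3!rewrite ?(size_cat, size_compile, sp) /=; lia.
  have [||tps1 rp1 e1] := @code_tm_jump C a r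
    (fun s => if c s then a.+1 else (a.+1 + len p).+1) m tps _ _ rp.
    by lia.
    by rewrite eC nth_cat sp ltnn subnn /=.
  have [|tps2 rp2 e2] := IHp C a.+1 tps1 _ rp1.
    exists (rcons pre (jump r (fun s => if c s then a.+1 else (a.+1 + len p).+1))).
    eexists; rewrite size_rcons sp; split=> //.
    by rewrite eC cat_rcons -catA.
  have [||tps3 rp3 e3] := @code_tm_jump C (a.+1 + len p) r
    (fun _ => a) m' tps2 _ _ rp2.
    by lia.
    rewrite eC nth_cat sp ifN; last by lia.
    have -> : (a.+1 + len p - a = (len p).+1)%N by lia.
    rewrite /= nth_cat nth_cat size_compile ltnn subnn /= size_cat size_compile.
    by rewrite /= ifT //; lia.
  (* The closing jump leads back to address [a], so the same code serves the remaining
     iterations. *)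
  have [tps4 rp4 e4] := IHw C a tps3 hC rp3.
  by exists tps4 => //; rewrite iterD iterD iterD [iter 1 _ (_, tps)]/= e1 hc e2 /= e3.
- move=> r c p m hc C a tps [pre [post [/= eC sp]]] rp.
  have [||tps1 rp1 e1] := @code_tm_jump C a r
    (fun s => if c s then a.+1 else (a.+1 + len p).+1) m tps _ _ rp.
  + by rewrite eC; do 3!rewrite ?(size_cat, size_compile, sp) /=; lia.
  + by rewrite eC nth_cat sp ltnn subnn /=.
  by exists tps1 => //; rewrite /= e1 (negbTE hc); congr (inord _, _); lia.
Qed.

Definition store_size (m : store) : nat :=
  size (su m) + size (ss m) + size (st m) + size (sn m).

(** No instruction adds more than one bit; hence a time bound is also a size bound. *)
Lemma exec_size p m m' t : exec p m m' t -> store_size m' <= store_size m + t.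
Proof.
elim=> {p m m' t}; rewrite /store_size; try by move=> *; lia.
- by case=> b m /=; lia.
- by case=> m /=; rewrite size_behead; lia.
Qed.

Lemma tm_step_halted M (c : config M) n :
  halting c.1 -> iter n (@tm_step M) c = c.
Proof. by move=> h; elim: n => //= n ->; rewrite /tm_step h. Qed.

Lemma computes_within_leq M x y t t' :
  t <= t' -> computes_within M x y t -> computes_within M x y t'.
Proof.
by move=> le [h e]; rewrite /computes_within -(subnK le) iterD tm_step_halted.
Qed.

Lemma exec_computes p x y m t :
  exec p (Store x [::] [::] [::]) m t -> sn m = y ->
  computes_within (code_tm (compile 0 p)) x y t.
Proof.
move=> ex ey; set C := compile 0 p.
have [||tps rp e] := exec_sim ex (C := C) (a := 0)
    (tps := (tm_init (code_tm C) x).2).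
- by exists [::], [::]; rewrite cats0.
- by move=> r; rewrite ffunE; exists 0; rewrite cats0; case: r.
have ei : tm_init (code_tm C) x = (inord 0, (tm_init (code_tm C) x).2).
  by rewrite /tm_init; congr pair; apply: val_inj; rewrite /= inordK.
rewrite /computes_within ei e /=; split.
  by apply/eqP/val_inj; rewrite /= add0n inordK /C size_compile.
have -> : ord_max = idx RN by apply: val_inj.
have [k ek] := rp RN; rewrite /tape_output ek /= ey.
have -> : index None (map Some y ++ nseq k None) = size y.
  rewrite index_cat ifN; first by rewrite size_map; case: (k) => [|?] /=; rewrite addn0.
  by elim: (y) => //= b w IH; rewrite inE.
by rewrite take_cat size_map ltnn subnn take0 cats0 (map_pK (g := Some)).
Qed.

(** * Composition of polynomial-time functions *)

(** Equality up to explicit blanks at the ends. Machines cannot see the difference, while idle and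
    copying steps do not preserve equality of the lists. *)
Definition eqtape (t1 t2 : tape) : Prop :=
  nth None t1.1 =1 nth None t2.1 /\ nth None t1.2 =1 nth None t2.2.

Lemma eqtape_trans t2 t1 t3 : eqtape t1 t2 -> eqtape t2 t3 -> eqtape t1 t3.
Proof. by move=> [e f] [g h]; split=> n; rewrite ?e ?f. Qed.

Lemma eqtape_refl t : eqtape t t. Proof. by []. Qed.

Lemma eqtape_read t1 t2 : eqtape t1 t2 -> tape_read t1 = tape_read t2.
Proof. by move=> [_ e]; rewrite /tape_read -!nth0 e. Qed.

Lemma eqtape_write s t1 t2 :
  eqtape t1 t2 -> eqtape (tape_write s t1) (tape_write s t2).
Proof. by move=> [e f]; split=> //= -[|n] //=; rewrite !nth_behead f. Qed.

Lemma eqtape_move d t1 t2 :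
  eqtape t1 t2 -> eqtape (tape_move d t1) (tape_move d t2).
Proof.
by move=> [e f]; case: d => [[]|] //; split=> -[|n] //=;
  rewrite ?nth_behead ?e ?f // -!nth0 ?e ?f.
Qed.

Lemma eqtape_touch t : eqtape (touch t) t.
Proof. by case: t => l [|s r]; split=> //= -[|[]]. Qed.

Lemma eqtape_touchW t u : eqtape t u -> eqtape (touch t) u.
Proof. exact: eqtape_trans (eqtape_touch t). Qed.

Lemma eqtape_output t1 t2 : eqtape t1 t2 -> tape_output t1 = tape_output t2.
Proof.
rewrite /tape_output; case: t1 t2 => [_ r1] [_ r2] [/= _].
elim: r1 r2 => [|s r1 IH] [|s' r2] //= e.
- by move: (e 0) => /= <-.
- by move: (e 0) => /= ->.
- move: (e 0) => /= <-; case: s {e}(fun n => e n.+1) => //= b e.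
  by rewrite (IH r2).
Qed.

Lemma tape_output_split (tp : tape) :
  exists2 rest, tp.2 = map Some (tape_output tp) ++ rest & head None rest = None.
Proof.
rewrite /tape_output; case: tp => _ /=; elim=> [|[b|] r [rest e h]] /=.
- by exists [::].
- by exists rest; rewrite // {1}e.
- by exists (None :: r).
Qed.

Lemma size_tape_output (tp : tape) : size (tape_output tp) <= size tp.2.
Proof.
by have [rest -> _] := tape_output_split tp; rewrite size_cat size_map leq_addr.
Qed.

(** Two cells: one from writing on an empty list, one from moving left. *)
Lemma tm_step_size M (c : config M) i :
  size ((tm_step c).2 i).2 <= (size (c.2 i).2).+2.
Proof.
rewrite /tm_step; case: ifP => [_|_]; first by lia.
rewrite /= ffunE; case: (_ i) => s [[]|] /=; rewrite size_behead; lia.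
Qed.

Lemma computes_within_size M x y t :
  computes_within M x y t -> size y <= size x + t.*2.
Proof.
move=> [_ <-]; apply: leq_trans (size_tape_output _) _.
elim: t => [|t IH] /=.
  by rewrite ffunE; case: ifP; rewrite /= ?size_map; lia.
by apply: leq_trans (tm_step_size _ _) _; lia.
Qed.

Section Composition.

Variables M1 M2 : turing_machine.

Let k1 := extra_tapes M1.
Let k2 := extra_tapes M2.
(** With the tapes of [M1] first, the input tape of the composite is that of [M1] and its output
    tape is that of [M2]. *)
Let L (i : 'I_k1.+1) : 'I_(k1.+1 + k2.+1) := lshift k2.+1 i.
Let R (i : 'I_k2.+1) : 'I_(k1.+1 + k2.+1) := rshift k1.+1 i.

(* [inl] runs [M1], [inr (inl false)] copies the output of [M1] to the input
   tape of [M2], [inr (inl true)] rewinds that tape, and [inr (inr _)] runs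
   [M2]. *)
Definition comp_state : finType := (state M1 + (bool + state M2))%type.

Definition comp_transition (q : comp_state)
    (rd : {ffun 'I_(k1.+1 + k2.+1) -> symbol}) :
    comp_state * {ffun 'I_(k1.+1 + k2.+1) -> symbol * direction} :=
  let stay := [ffun j => (rd j, None)] in
  match q with
  | inl q1 =>
      if halting q1 then (inr (inl false), stay) else
      let a := transition q1 [ffun i => rd (L i)] in
      (inl a.1, [ffun j => match split j with
                           | inl i => a.2 i
                           | inr _ => (rd j, None)
                           end])
  | inr (inl false) =>
      if rd (L ord_max) is Some b then
        (inr (inl false),
         [ffun j => if (j == L ord_max) || (j == R ord0)
                    then (Some b, Some true) else (rd j, None)])
      else (inr (inl true),
            [ffun j => (rd j, if j == R ord0 then Some false else None)])
  | inr (inl true) =>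
      if rd (R ord0) is Some b then
        (inr (inl true),
         [ffun j => (rd j, if j == R ord0 then Some false else None)])
      else (inr (inr (start M2)),
            [ffun j => (rd j, if j == R ord0 then Some true else None)])
  | inr (inr q2) =>
      let a := transition q2 [ffun i => rd (R i)] in
      (inr (inr a.1), [ffun j => match split j with
                                 | inl _ => (rd j, None)
                                 | inr i => a.2 i
                                 end])
  end.

Definition comp_tm : turing_machine :=
  @TuringMachine (k1 + k2.+1) comp_state (inl (start M1))
    (fun q => if q is inr (inr q2) then halting q2 else false)
    comp_transition.

Let C := config comp_tm.
Let cstep := @tm_step comp_tm.

Let splitL i : split (L i) = inl i.
Proof. exact: (unsplitK (inl _ i)). Qed.

Let splitR i : split (R i) = inr i.
Proof. exact: (unsplitK (inr _ i)). Qed.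

Let RL i j : (R i == L j) = false.
Proof. by apply/eqP => /(congr1 val) /=; have := ltn_ord j; lia. Qed.

Let Rinj i j : (R i == R j) = (i == j).
Proof. exact: (inj_eq (@rshift_inj _ _)). Qed.

Let sim1 (c : C) (c1 : config M1) : Prop :=
  [/\ c.1 = inl c1.1, forall i, c.2 (L i) = c1.2 i &
      forall i, eqtape (c.2 (R i)) ([::], [::])].

Let sim1_step c c1 : sim1 c c1 -> ~~ halting c1.1 ->
  sim1 (cstep c) (tm_step c1).
Proof.
case: c => q tps [/= -> eL eR] h.
rewrite /cstep /tm_step /= (negbTE h).
have -> : [ffun i => [ffun i0 => tape_read (tps i0)] (L i)] =
          [ffun i => tape_read (c1.2 i)].
  by apply/ffunP => i; rewrite !ffunE eL.
split=> //= i; rewrite !ffunE ?splitL ?splitR ?eL //.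
exact: eqtape_touchW.
Qed.

(** [M1] may halt before time [t], and one step later the composite is already in the copying state;
    hence [j] in place of [t]. *)
Let phase1 x t : exists2 j, j <= t &
  sim1 (iter j cstep (tm_init comp_tm x)) (iter t (@tm_step M1) (tm_init M1 x)).
Proof.
elim: t => [|t [j lej sj]].
  exists 0 => //; split=> //= i; rewrite !ffunE.
    by congr (tape_input (if _ then _ else _));
      apply/eqP/eqP => /(congr1 val) /= e; apply: val_inj.
  exact: eqtape_refl.
case: (boolP (halting (iter t (@tm_step M1) (tm_init M1 x)).1)) => h.
  by exists j; [lia | rewrite /= {1}/tm_step h].
by exists j.+1 => //=; apply: sim1_step.
Qed.

(* Only the input tape of [M2] may be non-blank. *)
Let ready (q : comp_state) (tp : tape) (c : C) : Prop :=
  [/\ c.1 = q, eqtape (c.2 (R ord0)) tp &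
      forall i, i != ord0 -> eqtape (c.2 (R i)) ([::], [::])].

(** [l] is the part already copied, nearest cell first. The extra step meets the blank after the
    output of [M1] and turns back left on the tape of [M2]. *)
Let phase2 w : forall rest (c : C) l, ready (inr (inl false)) (map Some l, [::]) c ->
  (c.2 (L ord_max)).2 = map Some w ++ rest -> head None rest = None ->
  ready (inr (inl true)) (tape_move (Some false) (map Some (catrev w l), [::]))
    (iter (size w).+1 cstep c).
Proof.
elim: w => [|b w IH] rest [q tps] l [/= -> e0 eR] eL h.
  rewrite /cstep /tm_step /= ffunE /tape_read eL h /=; split=> //=.
    rewrite !ffunE eqxx /=; exact: (eqtape_move (Some false) (eqtape_touchW e0)).
  move=> i ni; rewrite !ffunE Rinj (negbTE ni); exact: eqtape_touchW (eR i ni).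
rewrite -!iterS iterSr; apply: (IH rest).
- rewrite /cstep /tm_step /= ffunE /tape_read eL /=; split=> //=.
    rewrite !ffunE eqxx orbT /=.
    have [e1 e2] := eqtape_move (Some true) (eqtape_write (Some b) e0).
    by split=> n; rewrite ?e1 ?e2.
  move=> i ni; rewrite !ffunE Rinj (negbTE ni) RL /=.
  exact: eqtape_touchW (eR i ni).
- rewrite /cstep /tm_step /=.
  have -> : [ffun i => tape_read (tps i)] (L ord_max) = Some b.
    by rewrite ffunE /tape_read eL.
  by rewrite !ffunE eqxx /= eL.
- by [].
Qed.

(** The blank before the copied word marks its left end; the extra step moves from that blank back
    to the first bit. *)
Let phase3 l : forall (c : C) v,
  ready (inr (inl true)) (tape_move (Some false) (map Some l, map Some v)) c ->
  ready (inr (inr (start M2))) ([::], map Some (catrev l v))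
    (iter (size l).+1 cstep c).
Proof.
elim: l => [|b l IH] [q tps] v [/= -> e0 eR].
  rewrite /cstep /tm_step /= ffunE (eqtape_read e0) /=; split=> //=.
    rewrite !ffunE eqxx; apply: eqtape_trans.
      exact: (eqtape_move (Some true) (eqtape_touchW e0)).
    by split=> //= -[|[]].
  move=> i ni; rewrite !ffunE Rinj (negbTE ni); exact: eqtape_touchW (eR i ni).
rewrite -!iterS iterSr; apply: (IH _ (b :: v)).
rewrite /cstep /tm_step /= ffunE (eqtape_read e0) /=; split=> //=.
  rewrite !ffunE eqxx.
  exact: (eqtape_move (Some false) (eqtape_touchW e0)).
move=> i ni; rewrite !ffunE Rinj (negbTE ni); exact: eqtape_touchW (eR i ni).
Qed.

Let sim2 (c : C) (c2 : config M2) : Prop :=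
  c.1 = inr (inr c2.1) /\ forall i, eqtape (c.2 (R i)) (c2.2 i).

Let sim2_step c c2 : sim2 c c2 -> sim2 (cstep c) (tm_step c2).
Proof.
case: c => q tps [/= -> eR]; rewrite /cstep /tm_step /=.
case: ifP => // _.
have -> : [ffun i => [ffun i0 => tape_read (tps i0)] (R i)] =
          [ffun i => tape_read (c2.2 i)].
  by apply/ffunP => i; rewrite !ffunE; apply: eqtape_read.
split=> //= i; rewrite !ffunE splitR.
by apply: eqtape_move; apply: eqtape_write.
Qed.

(** The overhead is one step to start copying, [size y + 1] steps to copy and as many to rewind. *)
Lemma comp_tm_computes x y z t1 t2 :
  computes_within M1 x y t1 -> computes_within M2 y z t2 ->
  computes_within comp_tm x z (t1 + (size y).*2 + 3 + t2).
Proof.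
move=> [h1 o1] [h2 o2].
have [j lej [s1 sL sR]] := phase1 x t1.
set c1 := iter j cstep _ in s1 sL sR.
set d1 := iter t1 _ _ in h1 o1 s1 sL.
have rd0 : ready (inr (inl false)) ([::], [::]) (cstep c1).
  rewrite /cstep /tm_step s1 /= h1; split=> // [|i _]; rewrite !ffunE;
  exact: eqtape_touchW (sR _).
have eL : touch (d1.2 ord_max) = (cstep c1).2 (L ord_max).
  by rewrite /cstep /tm_step s1 /= h1 !ffunE sL.
have [rest er hr] := tape_output_split (touch (d1.2 ord_max)).
rewrite (eqtape_output (eqtape_touch _)) o1 eL in er.
have := phase3 (v := [::]) (phase2 (l := [::]) rd0 er hr).
rewrite !catrevE !cats0 revK size_rev.
rewrite -iterD; set m := (_ + _)%N => -[r1 r2 r3].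
have s0 : sim2 (iter m cstep (cstep c1)) (tm_init M2 y).
  split=> // i; rewrite ffunE.
  by case: ifP => [/eqP ->|/negbT /r3].
have {}s0 n : sim2 (iter n cstep (iter m cstep (cstep c1)))
                   (iter n (@tm_step M2) (tm_init M2 y)).
  by elim: n => //= n; apply: sim2_step.
apply: (@computes_within_leq _ _ _ (t2 + (m + j.+1))); first by rewrite /m; lia.
have e : iter (t2 + (m + j.+1)) cstep (tm_init comp_tm x) =
         iter t2 cstep (iter m cstep (cstep c1)) by rewrite !iterD.
rewrite /computes_within -/cstep e.
case: (s0 t2) => f1 f2; rewrite {1}/halting /= f1; split=> //.
have -> : ord_max = R ord_max by apply: val_inj; exact: (addnS k1 k2).
by rewrite (eqtape_output (f2 _)).
Qed.

End Composition.

(** As the base [n.+2] is at least 2, a power of it absorbs any constant coefficient, and the Horner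
    scheme only adds up exponents. *)
Lemma horner_nat_bound (p : {poly nat}) :
  exists k, forall n, p.[n]%R <= n.+2 ^ k.
Proof.
elim/poly_ind: p => [|p c [k IH]]; first by exists 0 => n; rewrite horner0.
exists (k.+1 + c.+1) => n; rewrite hornerMXaddC.
have hc : c <= n.+2 ^ c.
  apply: leq_trans (ltnW (ltn_expl c (isT : 1 < 2))) _.
  by case: c => // c; rewrite leq_exp2r.
have := IH n; rewrite -[(_ * _)%R]/(_ * _)%N -[(_ + _)%R]/(_ + _)%N.
move: (p.[n])%R => q hq.
have hk : 0 < n.+2 ^ k by rewrite expn_gt0.
rewrite expnD !expnS.
have hv : 0 < n.+2 ^ c by rewrite expn_gt0.
move: (n.+2 ^ k) (n.+2 ^ c) hk hv hq hc => u v hk hv hq hc.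
have qn : q * n <= u * n.+2 by rewrite leq_mul //; lia.
have uv : u * n.+2 + v <= 2 * (u * n.+2 * v) by nia.
have : 2 * (u * n.+2 * v) <= n.+2 * (u * n.+2 * v) by rewrite leq_mul.
have -> : n.+2 * u * (n.+2 * v) = n.+2 * (u * n.+2 * v) by lia.
by lia.
Qed.

Lemma polytimeP f : polytime f <->
  exists M k, forall x, computes_within M x (f x) ((size x).+2 ^ k).
Proof.
split=> [[M [p Mp]]|[M [k Mk]]]; exists M.
  have [k pk] := horner_nat_bound p; exists k => x.
  exact: computes_within_leq (pk _) (Mp x).
exists (('X + 2%:R%:P) ^+ k)%R => x.
have -> : (('X + 2%:R%:P) ^+ k).[size x]%R = (size x).+2 ^ k.
  rewrite horner_exp hornerD hornerX hornerC.
  rewrite -[(_ + _)%R]/(size x + 2)%N addn2.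
  by elim: k {Mk} => // k IH; rewrite exprS IH expnS.
exact: Mk.
Qed.

Lemma polytime_comp f g : polytime f -> polytime g -> polytime (g \o f).
Proof.
move=> /polytimeP [M1 [k1 c1]] /polytimeP [M2 [k2 c2]].
(* Put Y = (n + 2)^(k1 + 3). Then [size (f x) + 2] is at most Y, so the second machine runs within
   Y^k2; the factor Y^2 absorbs the first machine and the copying, since Y is at least 8. *)
apply/polytimeP; exists (comp_tm M1 M2), ((k1 + 3) * (k2 + 2)) => x.
apply: computes_within_leq (comp_tm_computes (c1 x) (c2 (f x))).
have := computes_within_size (c1 x).
move: (size x) (size (f x)) => n m le.
have leY : m.+2 <= n.+2 ^ (k1 + 3).
  have : 0 < n.+2 ^ k1 by rewrite expn_gt0.
  by rewrite expnD; move: (n.+2 ^ k1) le => u; rewrite !expnS expn0; nia.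
have leY1 : n.+2 ^ k1 <= n.+2 ^ (k1 + 3) by rewrite leq_exp2l // leq_addr.
have leY8 : 8 <= n.+2 ^ (k1 + 3).
  by apply: leq_trans (leq_pexp2l _ (leq_addl k1 3)) => //; rewrite !expnS; nia.
have lez : m.+2 ^ k2 <= (n.+2 ^ (k1 + 3)) ^ k2.
  by case: (k2) => // k; rewrite leq_exp2r.
rewrite expnM (expnD _ k2) -mulnn.
have : 0 < (n.+2 ^ (k1 + 3)) ^ k2 by rewrite !expn_gt0.
move: leY leY1 leY8 lez; move: (n.+2 ^ k1) (m.+2 ^ k2) => u v.
move: (n.+2 ^ (k1 + 3)) => Y leY leY1 leY8; move: (Y ^ k2) => z lez z0.
have : 8 * Y * z <= z * (Y * Y) by rewrite mulnC leq_pmul2l // leq_pmul2r //; lia.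
have : Y <= Y * z by rewrite leq_pmulr.
have : z <= Y * z by rewrite leq_pmull; lia.
by rewrite -mulnA; move: (Y * z) => W; lia.
Qed.

(** * Polynomial-time functions on encodable types *)

Definition run (p : prog) (m m' : store) (b : nat) : Prop :=
  exists2 t, t <= b & exec p m m' t.

Lemma run_leq p m m' b b' : b <= b' -> run p m m' b -> run p m m' b'.
Proof. by move=> le [t tb e]; exists t => //; lia. Qed.

Lemma run_skip m : run Skip m m 0.
Proof. by exists 0 => //; constructor. Qed.

Lemma run_push r b m : run (Push r b) m (upd r (b :: get r m) m) 2.
Proof. by exists 2 => //; constructor. Qed.

Lemma run_pop r m : run (Pop r) m (upd r (behead (get r m)) m) 1.
Proof. by exists 1 => //; constructor. Qed.

Lemma run_seq m2 p q m1 m3 b1 b2 :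
  run p m1 m2 b1 -> run q m2 m3 b2 -> run (Seq p q) m1 m3 (b1 + b2).
Proof.
move=> [t1 l1 e1] [t2 l2 e2]; exists (t2 + t1); first by lia.
exact: ExSeq e1 e2.
Qed.

Lemma run_if r (c : symbol -> bool) p q m m' b :
  run (if c (top (get r m)) then p else q) m m' b ->
  run (If r c p q) m m' b.+2.
Proof.
case: ifP => hc [t lt e].
  by exists (1 + (t + 1)); [lia | exact: ExIfT].
by exists (t + 1); [lia | apply: ExIfF => //; rewrite hc].
Qed.

Lemma run_while m' r (c : symbol -> bool) p m m'' b b' :
  c (top (get r m)) -> run p m m' b -> run (While r c p) m' m'' b' ->
  run (While r c p) m m'' (b + b' + 2).
Proof.
move=> hc [t lt e] [t' lt' e']; exists (t' + (1 + (t + 1))); first by lia.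
exact: ExWhileT e e'.
Qed.

Lemma run_while_end r (c : symbol -> bool) p m :
  ~~ c (top (get r m)) -> run (While r c p) m m 1.
Proof. by move=> hc; exists 1 => //; apply: ExWhileF. Qed.

Definition is_one (s : symbol) : bool := s == Some true.

Definition drain (r : reg) (f : bool -> prog) : prog :=
  While r isSome (If r is_one (Seq (Pop r) (f true)) (Seq (Pop r) (f false))).

(* [g d w] is the store when [w] is left and [d] has been read, last bit
   first. *)
Lemma run_drain r f c (g : bits -> bits -> store) :
  (forall d w, get r (g d w) = w) ->
  (forall d b w, run (f b) (upd r w (g d (b :: w))) (g (b :: d) w) c) ->
  forall w d, run (drain r f) (g d w) (g (catrev w d) [::]) ((c + 5) * size w).+1.
Proof.
move=> gr gf; elim=> [|b w IH] d /=.
  by rewrite muln0; apply: run_while_end; rewrite gr.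
rewrite mulnS; apply: run_leq; last first.
  apply: run_while (IH (b :: d)); first by rewrite gr.
  apply: run_if; rewrite gr /=.
  have := run_pop r (g d (b :: w)); rewrite gr /= => rp.
  by case: b gf rp => gf rp; apply: run_seq rp (gf _ _ _).
by lia.
Qed.

(** * Prefix codes of trees and stack operations on them *)

Inductive tree := Leaf | Node (a b : tree).

Fixpoint code (a : tree) : bits :=
  if a is Node a1 a2 then true :: code a1 ++ code a2 else [:: false].

Lemma size_code_gt0 a : 0 < size (code a). Proof. by case: a. Qed.

Definition grab_loop (r : reg) : prog :=
  While RN isSome (If RS is_one
    (Seq (Pop RS) (Seq (Push r true) (Push RN true)))
    (Seq (Pop RS) (Seq (Push r false) (Pop RN)))).

(* Moves the tree on top of [RS] to [r], reversed; [RN] counts, in unary, the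
   subtrees that remain to be read. *)
Definition grab (r : reg) : prog := Seq (Push RN true) (grab_loop r).

(** In continuation form, because the loop does not stop after one tree but goes on with the pending
    ones; this lets the induction treat the two subtrees of a node in succession. One iteration
    costs 9 steps per bit of code. *)
Lemma run_grab_loop r a : r = RT \/ r = RU -> forall u s t n m' b,
  run (grab_loop r) (upd r (rev (code a) ++ get r (Store u s t n))
                           (Store u s t n)) m' b ->
  run (grab_loop r) (Store u (code a ++ s) t (true :: n)) m'
      (b + 9 * size (code a)).
Proof.
move=> hr; elim: a => [|a1 IH1 a2 IH2] u s t n m' b h.
  apply: run_leq; last first.
    apply: run_while h => //; apply: run_if => /=.
    apply: run_seq (run_pop _ _) _; apply: run_seq (run_push _ _ _) _.
    by case: hr => ->; apply: run_pop.
  by rewrite /=; lia.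
apply: run_leq; last first.
  apply: (run_while (m' := upd r (true :: get r (Store u s t n))
      (Store u (code a1 ++ code a2 ++ s) t (true :: true :: n)))) => //.
    apply: run_if => /=.
    apply: run_seq (run_pop _ _) _; apply: run_seq (run_push _ _ _) _.
    by rewrite /= -catA; case: hr => ->; apply: run_push.
  case: hr IH1 IH2 h => -> IH1 IH2 h /=; apply: IH1; apply: IH2;
  by move: h; rewrite /= rev_cons rev_cat cat_rcons -catA; apply.
by rewrite /= size_cat; lia.
Qed.

Lemma run_grab r a u s t : r = RT \/ r = RU ->
  run (grab r) (Store u (code a ++ s) t [::])
    (upd r (rev (code a) ++ get r (Store u s t [::])) (Store u s t [::]))
    (12 * size (code a)).
Proof.
move=> hr; apply: run_leq; last first.
  apply: run_seq (run_push _ _ _) _; apply: run_grab_loop => //.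
  by apply: run_while_end; case: hr => ->.
by have := size_code_gt0 a; lia.
Qed.

Definition stk (s : bits) : store := Store [::] s [::] [::].

Definition drop_top : prog := Seq (grab RU) (drain RU (fun _ => Skip)).

Lemma run_drop a s : run drop_top (stk (code a ++ s)) (stk s) (18 * size (code a)).
Proof.
apply: run_leq; last first.
  apply: run_seq; first by apply: run_grab; right.
  apply: (@run_drain RU _ 0 (fun d w => Store w s [::] [::]) _ _ _ [::]) => //.
  by move=> *; apply: run_skip.
by rewrite cats0 size_rev; have := size_code_gt0 a; lia.
Qed.

Lemma run_restore_T u s w n :
  run (drain RT (Push RS)) (Store u s (rev w) n) (Store u (w ++ s) [::] n)
    (7 * size w).+1.
Proof.
have := @run_drain RT (Push RS) 2 (fun d w => Store u (d ++ s) w n)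
  (fun _ _ => erefl) (fun _ _ _ => run_push _ _ _) (rev w) [::].
by rewrite -[catrev _ _]/(rev _) revK size_rev.
Qed.

Lemma run_restore_U s t w n :
  run (drain RU (Push RS)) (Store (rev w) s t n) (Store [::] (w ++ s) t n)
    (7 * size w).+1.
Proof.
have := @run_drain RU (Push RS) 2 (fun d w => Store w (d ++ s) t n)
  (fun _ _ => erefl) (fun _ _ _ => run_push _ _ _) (rev w) [::].
by rewrite -[catrev _ _]/(rev _) revK size_rev.
Qed.

Definition swap_top : prog :=
  Seq (grab RT) (Seq (grab RU)
    (Seq (drain RT (Push RS)) (drain RU (Push RS)))).

Lemma run_swap a b s : run swap_top (stk (code a ++ code b ++ s))
  (stk (code b ++ code a ++ s)) (21 * (size (code a) + size (code b))).
Proof.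
apply: run_leq; last first.
  apply: run_seq; first by apply: run_grab; left.
  apply: run_seq; first by apply: run_grab; right.
  rewrite /= !cats0.
  exact: run_seq (run_restore_T _ _ _ _) (run_restore_U _ _ _ _).
have := size_code_gt0 a; have := size_code_gt0 b; lia.
Qed.

(** The copy on [RU] has its first bit on top; it must be reversed through [RT] before it can be
    pushed back on [RS]. *)
Definition dup_top : prog :=
  Seq (grab RT) (Seq (drain RT (fun b => Seq (Push RS b) (Push RU b)))
    (Seq (drain RU (Push RT)) (drain RT (Push RS)))).

Lemma run_dup a s : run dup_top (stk (code a ++ s))
  (stk (code a ++ code a ++ s)) (40 * size (code a)).
Proof.
have r1 := @run_drain RT (fun b => Seq (Push RS b) (Push RU b)) 4
  (fun d w => Store d (d ++ s) w [::]) (fun _ _ => erefl)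
  (fun _ _ _ => run_seq (run_push _ _ _) (run_push _ _ _)) (rev (code a)) [::].
have r2 := @run_drain RU (Push RT) 2
  (fun d w => Store w (code a ++ s) d [::]) (fun _ _ => erefl)
  (fun _ _ _ => run_push _ _ _) (code a) [::].
rewrite -[catrev _ _]/(rev _) revK size_rev in r1.
apply: run_leq; last first.
  apply: run_seq; first by apply: run_grab; left.
  rewrite /= cats0; apply: run_seq r1 _; apply: run_seq r2 _.
  exact: run_restore_T.
have := size_code_gt0 a; lia.
Qed.

Definition push_word (w : bits) : prog :=
  foldr (fun b p => Seq p (Push RS b)) Skip w.

Lemma run_push_word w u s t n :
  run (push_word w) (Store u s t n) (Store u (w ++ s) t n) (2 * size w).
Proof.
elim: w => [|b w IH] /=; first exact: run_skip.
apply: run_leq; last by apply: run_seq IH _; apply: run_push.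
by lia.
Qed.

(** * Encodable types, polynomial bounds and basic polynomial-time functions *)

Structure encType := EncType { enc_sort :> Type; toT : enc_sort -> tree }.

Arguments toT {_} _.

Canonical unit_encType := EncType (fun _ : unit => Leaf).

(** The first bit of the code is the truth value, just as for lists it tells whether they are
    nonempty; a test of the top of [RS] is enough for case distinction. *)
Canonical bool_encType :=
  EncType (fun b : bool => if b then Node Leaf Leaf else Leaf).

(** Unary, with the same code as a list of [n] units, so that iteration up to [n] is a fold over a
    list. *)
Canonical nat_encType := EncType (fun n : nat => iter n (Node Leaf) Leaf).

Canonical prod_encType (A B : encType) :=
  EncType (fun x : A * B => Node (toT x.1) (toT x.2)).

Canonical seq_encType (A : encType) :=
  EncType (foldr (fun x : A => Node (toT x)) Leaf).

Definition sz {A : encType} (x : A) : nat := size (code (toT x)).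

Lemma sz_gt0 {A : encType} (x : A) : 0 < sz x. Proof. exact: size_code_gt0. Qed.

Lemma sz_pair {A B : encType} (x : A * B) : sz x = (sz x.1 + sz x.2).+1.
Proof. by rewrite /sz /= size_cat. Qed.

Lemma sz_cons {A : encType} (x : A) (l : seq A) : sz (x :: l) = (sz x + sz l).+1.
Proof. by rewrite /sz /= size_cat. Qed.

Lemma sz_nat (n : nat) : sz n = n.*2.+1.
Proof. by elim: n => //= n; rewrite /sz /= => ->; rewrite doubleS. Qed.

Lemma sz_bool (b : bool) : sz b <= 3. Proof. by case: b. Qed.

Lemma size_leq_sz {A : encType} (l : seq A) : size l < sz l.
Proof. by elim: l => //= x l IH; rewrite sz_cons; have := sz_gt0 x; lia. Qed.

Lemma sz_cat {A : encType} (k l : seq A) : (sz (k ++ l)).+1 = sz k + sz l.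
Proof. by elim: k => //= x k IH; rewrite !sz_cons; lia. Qed.

(* Bounds of this shape absorb constants and are closed under sums, products and
   composition. *)
Definition PB {A : encType} (g : A -> nat) : Prop :=
  exists k, forall x, g x <= (sz x).+2 ^ k.

Section PolynomialBounds.
Context {A : encType}.
Implicit Types f g : A -> nat.

Lemma PB_leq f g : (forall x, f x <= g x) -> PB g -> PB f.
Proof. by move=> le [k gk]; exists k => x; apply: leq_trans (le x) (gk x). Qed.

Lemma PB_const c : PB (fun _ : A => c).
Proof.
exists c => x; apply: leq_trans (ltnW (ltn_expl c (isT : 1 < 2))) _.
by case: c => // c; rewrite leq_exp2r.
Qed.

Lemma PB_sz : PB (fun x : A => sz x).
Proof. by exists 1 => x; rewrite expn1; lia. Qed.

Lemma PB_add f g : PB f -> PB g -> PB (fun x => f x + g x).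
Proof.
move=> [i fi] [j gj]; exists (i + j).+1 => x; rewrite expnS expnD.
have: 0 < (sz x).+2 ^ i by rewrite expn_gt0.
have: 0 < (sz x).+2 ^ j by rewrite expn_gt0.
move: (_ ^ i) (_ ^ j) (fi x) (gj x) => u v fu gv v0 u0.
have : 2 * (u * v) <= (sz x).+2 * (u * v) by rewrite leq_mul.
by nia.
Qed.

Lemma PB_mul f g : PB f -> PB g -> PB (fun x => f x * g x).
Proof.
by move=> [i fi] [j gj]; exists (i + j) => x; rewrite expnD leq_mul.
Qed.

Lemma PB_exp f k : PB f -> PB (fun x => f x ^ k).
Proof.
move=> fb; elim: k => [|k IH]; first exact: PB_const 1.
by apply: PB_leq (PB_mul fb IH) => x; rewrite expnS.
Qed.

Lemma PB_comp {B : encType} (h : B -> nat) (f : A -> B) :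
  PB h -> PB (fun x => sz (f x)) -> PB (fun x => h (f x)).
Proof.
move=> [k hk] fb; apply: PB_leq (fun x => hk (f x)) _.
by apply: PB_exp; apply: PB_leq (PB_add (PB_const 2) fb).
Qed.

End PolynomialBounds.

(* The rest [s] of the stack is left alone and does not enter the time bound. *)
Definition PT {A B : encType} (f : A -> B) : Prop :=
  exists p k, forall x s,
    run p (stk (code (toT x) ++ s)) (stk (code (toT (f x)) ++ s))
      ((sz x).+2 ^ k).

Lemma PT_intro {A B : encType} (f : A -> B) p (g : A -> nat) :
  PB g -> (forall x s, run p (stk (code (toT x) ++ s))
                             (stk (code (toT (f x)) ++ s)) (g x)) -> PT f.
Proof.
by move=> [k gk] r; exists p, k => x s; apply: run_leq (gk x) (r x s).
Qed.

(** A program cannot write more than its running time allows. This keeps the argument of the outer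
    function polynomial in a composition. *)
Lemma PT_sz {A B : encType} (f : A -> B) : PT f -> PB (fun x => sz (f x)).
Proof.
move=> [p [k r]]; apply: (@PB_leq _ _ (fun x => sz x + (sz x).+2 ^ k)).
  move=> x; have [t lt /exec_size] := r x [::].
  by rewrite /store_size /= !cats0 -/(sz x) -/(sz (f x)); lia.
apply: PB_add PB_sz (PB_exp _ _).
exact: PB_leq (PB_add (PB_const 2) PB_sz).
Qed.

Section BasicFunctions.
Context {A B C : encType}.

(** Only codes are compared, so the result type may change: a pair can be turned into a nonempty
    list or a list of units into a number at no cost. *)
Lemma PT_ext (f : A -> B) (g : A -> C) : (forall x, toT (f x) = toT (g x)) -> PT f -> PT g.
Proof. by move=> e [p [k r]]; exists p, k => x s; rewrite -e; apply: r. Qed.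

Lemma PT_id : PT (fun x : A => x).
Proof.
apply: (PT_intro (p := Skip) (PB_const 0)) => x s; exact: run_skip.
Qed.

Lemma PT_comp (h : B -> C) (f : A -> B) : PT h -> PT f -> PT (fun x => h (f x)).
Proof.
move=> [q [j rq]] hf; have [p [k rp]] := hf.
apply: (@PT_intro _ _ _ (Seq p q) (fun x => (sz x).+2 ^ k + (sz (f x)).+2 ^ j)).
  apply: PB_add; first by exists k.
  apply: (PB_comp (h := fun y => (sz y).+2 ^ j)); last exact: PT_sz.
  by exists j.
by move=> x s; apply: run_seq (rp x s) (rq _ s).
Qed.

Lemma PT_const (c : B) : PT (fun _ : A => c).
Proof.
apply: (@PT_intro _ _ _ (Seq drop_top (push_word (code (toT c))))
  (fun x => 18 * sz x + 2 * sz c)).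
  apply: PB_add (PB_mul (PB_const _) PB_sz) (PB_const _).
by move=> x s; apply: run_seq (run_drop _ _) (run_push_word _ _ _ _ _).
Qed.

Lemma PT_pair (f : A -> B) (g : A -> C) : PT f -> PT g -> PT (fun x => (f x, g x)).
Proof.
move=> hf hg; have [[p [k rp]] [q [j rq]]] := (hf, hg).
apply: (@PT_intro _ _ _
  (Seq dup_top (Seq p (Seq swap_top (Seq q (Seq swap_top (Push RS true))))))
  (fun x => 40 * sz x + ((sz x).+2 ^ k + (21 * (sz (f x) + sz x) +
    ((sz x).+2 ^ j + (21 * (sz (g x) + sz (f x)) + 2)))))).
  have hb := PT_sz hf; have hc := PT_sz hg; have ha := @PB_sz A.
  have hk : PB (fun x : A => (sz x).+2 ^ k) by exists k.
  have hj : PB (fun x : A => (sz x).+2 ^ j) by exists j.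
  by do ?[apply: PB_add | apply: PB_mul | apply: PB_const | assumption].
move=> x s; apply: run_seq (run_dup _ _) _; apply: run_seq (rp x _) _.
apply: run_seq (run_swap _ _ _) _; apply: run_seq (rq x _) _.
apply: run_seq (run_swap _ _ _) _; rewrite /= -catA; exact: run_push.
Qed.

End BasicFunctions.

Section Destructors.
Context {A B C : encType}.

Lemma PT_fst (f : A -> B * C) : PT f -> PT (fun x => (f x).1).
Proof.
apply: (PT_comp (h := fst)).
apply: (@PT_intro _ _ _ (Seq (Pop RS) (Seq swap_top drop_top))
  (fun x => 1 + (21 * sz x + 18 * sz x))).
  by do ?[apply: PB_add | apply: PB_mul | apply: PB_const | apply: PB_sz].
move=> x s; apply: (run_seq (run_pop _ _)); rewrite /= -catA.
apply: run_leq; last exact: run_seq (run_swap _ _ _) (run_drop _ _).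
by rewrite sz_pair /sz; lia.
Qed.

Lemma PT_snd (f : A -> B * C) : PT f -> PT (fun x => (f x).2).
Proof.
apply: (PT_comp (h := snd)).
apply: (@PT_intro _ _ _ (Seq (Pop RS) drop_top) (fun x => 1 + 18 * sz x)).
  by do ?[apply: PB_add | apply: PB_mul | apply: PB_const | apply: PB_sz].
move=> x s; apply: (run_seq (run_pop _ _)); rewrite /= -catA.
apply: run_leq; last exact: run_drop.
by rewrite sz_pair /sz; lia.
Qed.

Lemma PT_if (c : A -> bool) (f g : A -> B) :
  PT c -> PT f -> PT g -> PT (fun x => if c x then f x else g x).
Proof.
move=> [pc [kc rc]] [pf [kf rf]] [pg [kg rg]].
(* The code of a boolean has at most 3 bits, so dropping it costs at most 18 * 3 = 54. *)
apply: (@PT_intro _ _ _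
  (Seq dup_top (Seq pc (If RS is_one (Seq drop_top pf) (Seq drop_top pg))))
  (fun x => 40 * sz x + ((sz x).+2 ^ kc +
    (54 + (sz x).+2 ^ kf + (sz x).+2 ^ kg + 2)))).
  have ha := @PB_sz A.
  have hk k : PB (fun x : A => (sz x).+2 ^ k) by exists k.
  by do ?[apply: PB_add | apply: PB_mul | apply: PB_const | apply: hk | assumption].
move=> x s; apply: run_seq (run_dup _ _) _; apply: run_seq (rc x _) _.
rewrite addn2; apply: run_if => /=; case: (c x) => /=.
  apply: run_leq (run_seq (@run_drop (Node Leaf Leaf) _) (rf x s)).
  by rewrite /=; lia.
apply: run_leq (run_seq (@run_drop Leaf _) (rg x s)).
by rewrite /=; lia.
Qed.

Lemma PT_cons (f : A -> B) (g : A -> seq B) :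
  PT f -> PT g -> PT (fun x => f x :: g x).
Proof. by move=> hf hg; apply: PT_ext (PT_pair hf hg). Qed.

Lemma PT_cons_p (f : A -> seq B) : PT f -> PT (fun x => ~~ nilp (f x)).
Proof.
apply: (PT_comp (h := fun l => ~~ nilp l)).
apply: (@PT_intro _ _ _
  (If RS is_one (Seq drop_top (push_word [:: true; false; false])) Skip)
  (fun x => 18 * sz x + 6 + 2)).
  by do ?[apply: PB_add | apply: PB_mul | apply: PB_const | apply: PB_sz].
move=> l s; rewrite addn2; apply: run_if; case: l => [|y l] /=.
  by apply: run_leq (run_skip _).
exact: run_seq (@run_drop (toT (y :: l)) s)
  (run_push_word [:: true; false; false] _ s _ _).
Qed.

Lemma PT_behead (f : A -> seq B) : PT f -> PT (fun x => behead (f x)).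
Proof.
apply: (PT_comp (h := behead)).
apply: (@PT_intro _ _ _ (If RS is_one (Seq (Pop RS) drop_top) Skip)
  (fun x => 1 + 18 * sz x + 2)).
  by do ?[apply: PB_add | apply: PB_mul | apply: PB_const | apply: PB_sz].
move=> l s; rewrite addn2; apply: run_if; case: l => [|y l] /=.
  by apply: run_leq (run_skip _).
apply: run_seq (run_pop _ _) _; rewrite /= -catA.
apply: run_leq (run_drop _ _); rewrite sz_cons /sz; lia.
Qed.

Lemma PT_head d (f : A -> seq B) : PT f -> PT (fun x => head d (f x)).
Proof.
apply: (PT_comp (h := head d)).
apply: (@PT_intro _ _ _ (If RS is_one (Seq (Pop RS) (Seq swap_top drop_top))
    (Seq drop_top (push_word (code (toT d)))))
  (fun x => 1 + (21 * sz x + 18 * sz x) + 2 * sz d + 2)).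
  by do ?[apply: PB_add | apply: PB_mul | apply: PB_const | apply: PB_sz].
move=> l s; rewrite addn2; apply: run_if; case: l => [|y l] /=.
  apply: run_leq (run_seq (@run_drop Leaf _) (run_push_word _ _ _ _ _)).
  by rewrite /sz /=; lia.
apply: run_leq; last first.
  apply: run_seq (run_pop _ _) _; rewrite /= -catA.
  exact: run_seq (run_swap _ _ _) (run_drop _ _).
by rewrite sz_cons /sz -[foldr _ _ l]/(toT l); lia.
Qed.

End Destructors.

(** A step that is polynomial in its argument may still square the accumulator, so a bound on the
    accumulator along every prefix of the list is assumed. *)
Lemma PT_foldl_bounded {A B C : encType} (b0 : B)
    (f : A -> C -> B -> C) (z : A -> C) (l : A -> seq B) (bound : A -> nat) :
  PT (fun p : A * C * B => f p.1.1 p.1.2 p.2) -> PT z -> PT l -> PB bound ->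
  (forall a l1 l2, l a = l1 ++ l2 -> sz (foldl (f a) (z a) l1) <= bound a) ->
  PT (fun a => foldl (f a) (z a) (l a)).
Proof.
move=> hf hz hl hb le.
pose step (x : seq B * (A * C)) : seq B * (A * C) :=
  (behead x.1, (x.2.1, f x.2.1 x.2.2 (head b0 x.1))).
have [p [k rp]] : PT step.
  apply: PT_pair; first by apply: PT_behead; apply: PT_fst; apply: PT_id.
  apply: PT_pair; first by apply: PT_fst; apply: PT_snd; apply: PT_id.
  apply: (PT_comp (f := fun x => (x.2, head b0 x.1)) hf).
  apply: PT_pair; first by apply: PT_snd; apply: PT_id.
  by apply: PT_head; apply: PT_fst; apply: PT_id.
have [q [j rq]] : PT (fun a => (l a, (a, z a))).
  by apply: PT_pair => //; apply: PT_pair => //; apply: PT_id.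
(* Between iterations the leading bit of the outer pair is removed, so that the top of the stack is
   the first bit of the remaining list and serves as loop condition; the body puts it back around
   [step]. *)
pose W := While RS is_one (Seq (Push RS true) (Seq p (Pop RS))).
pose R a := (sz (l a) + sz a + bound a).+4 ^ k.
(* Loop invariant: [l1] has been folded and [l2] remains. [R a] bounds the time of each single
   step. *)
have rW a s l2 : forall l1, l a = l1 ++ l2 ->
    run W (stk (code (toT l2) ++ code (toT (a, foldl (f a) (z a) l1)) ++ s))
      (stk (false :: code (toT (a, foldl (f a) (z a) (l a))) ++ s))
      (size l2 * (R a + 6) + 1).
  elim: l2 => [|b l2 IH] l1 e.
    by rewrite e cats0; apply: run_while_end.
  rewrite /= mulSn; apply: run_leq; last first.
    apply: run_while (IH (rcons l1 b) _); rewrite ?cat_rcons //.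
    apply: run_seq (run_push _ _ _) _.
    have := rp (b :: l2, (a, foldl (f a) (z a) l1)) s.
    rewrite foldl_rcons /= -!catA => r1.
    apply: run_seq r1 _; rewrite /= -catA; exact: run_pop.
  have : sz ((b :: l2, (a, foldl (f a) (z a) l1)) : seq B * (A * C)) <=
         (sz (l a) + sz a + bound a).+2.
    have := le _ _ _ e; have := sz_cat l1 (b :: l2).
    have := sz_gt0 l1.
    by rewrite e !sz_pair /=; lia.
  set x := sz _ => lex.
  have : x.+2 ^ k <= R a by rewrite /R; case: (k) => // k'; rewrite leq_exp2r // !ltnS.
  by lia.
pose F a := (a, foldl (f a) (z a) (l a)).
suff : PT F by move/(PT_snd); apply.
apply: (@PT_intro _ _ _ (Seq q (Seq (Pop RS) (Seq W (Pop RS))))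
  (fun a => (sz a).+2 ^ j + (1 + (sz (l a) * (R a + 6) + 1 + 1)))).
  have hs := @PB_sz A; have hls := PT_sz hl.
  have hj : PB (fun x : A => (sz x).+2 ^ j) by exists j.
  have hR : PB R.
    apply: PB_exp; apply: PB_leq (PB_add (PB_const 4) (PB_add (PB_add hls hs) hb)) => a.
    by lia.
  by do ?[apply: PB_add | apply: PB_mul | apply: PB_const | assumption].
move=> a s; apply: run_seq (rq a s) _; apply: run_seq (run_pop _ _) _.
rewrite /= -catA.
apply: (run_seq (m2 := stk (false :: code (toT (F a)) ++ s))); last exact: run_pop.
apply: run_leq (rW a s (l a) [::] erefl).
by rewrite leq_add2r leq_mul2r ltnW ?orbT ?size_leq_sz.
Qed.

Definition read_input : prog :=
  Seq (drain RU (Push RT)) (Seq (Push RS false)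
    (drain RT (fun b => push_word (true :: code (toT b))))).

(** The code of a list has to be pushed from its end, beginning with the [false] of the empty list;
    hence the reversal through [RT]. *)
Lemma run_read_input (x : bits) :
  run read_input (Store x [::] [::] [::]) (stk (code (toT x))) (20 * size x + 4).
Proof.
have r1 := @run_drain RU (Push RT) 2
  (fun d w => Store w [::] d [::]) (fun _ _ => erefl)
  (fun _ _ _ => run_push _ _ _) x [::].
have r2 := @run_drain RT (fun b => push_word (true :: code (toT b))) 8
  (fun d w => Store [::] (code (toT d)) w [::]) (fun _ _ => erefl) _ (rev x) [::].
rewrite -[catrev (rev _) _]/(rev _) revK size_rev in r2.
apply: run_leq; last first.
  apply: run_seq r1 _; apply: (run_seq (run_push _ _ _)); apply: r2 => d b w.
  by apply: run_leq (run_push_word (true :: code (toT b)) _ _ _ _); case: b.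
by lia.
Qed.

Definition write_output : prog :=
  Seq (While RS is_one (Seq (Pop RS) (If RS is_one
        (Seq (Pop RS) (Seq (Pop RS) (Seq (Pop RS) (Push RT true))))
        (Seq (Pop RS) (Push RT false)))))
    (drain RT (Push RN)).

(** The code of the empty list remains on [RS], where it does no harm: the output is read from
    [RN]. *)
Lemma run_write_output (y : bits) :
  run write_output (stk (code (toT y))) (Store [::] [:: false] [::] y)
    (20 * size y + 4).
Proof.
rewrite /write_output; set W := While RS is_one _.
have r1 d : run W (Store [::] (code (toT y)) d [::])
    (Store [::] [:: false] (catrev y d) [::]) (10 * size y + 1).
  elim: y d => [|b y IH] d; first exact: run_while_end.
  apply: run_leq; last first.
    apply: run_while (IH (b :: d)) => //; apply: run_seq (run_pop _ _) _.
    apply: run_if; instantiate (1 := 5); case: b => /=.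
      do 3![apply: (@run_seq _ _ _ _ _ 1) (run_pop _ _) _]; exact: run_push.
    apply: (@run_leq _ _ _ 3) => //.
    apply: (@run_seq _ _ _ _ _ 1) (run_pop _ _) _; exact: run_push.
  by rewrite /=; lia.
have r2 := @run_drain RT (Push RN) 2
  (fun d w => Store [::] [:: false] w d) (fun _ _ => erefl)
  (fun _ _ _ => run_push _ _ _) (rev y) [::].
rewrite -[catrev (rev _) _]/(rev _) revK size_rev in r2.
by apply: run_leq (run_seq (r1 [::]) r2); lia.
Qed.

Lemma sz_bits (x : bits) : sz x <= 4 * size x + 1.
Proof.
by elim: x => //= b x IH; rewrite sz_cons; have := sz_bool b; lia.
Qed.

Lemma polytime_of_PT (f : bits -> bits) : PT f -> polytime f.
Proof.
move=> hf; have [p [k rp]] := hf.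
have [j hj] : PB (fun x : bits =>
    20 * sz x + 4 + ((sz x).+2 ^ k + (20 * sz (f x) + 4))).
  have hk : PB (fun x : bits => (sz x).+2 ^ k) by exists k.
  by have h1 := PT_sz hf; have h2 := @PB_sz (seq_encType bool_encType);
     do ?[apply: PB_add | apply: PB_mul | apply: PB_const | assumption].
apply/polytimeP.
(* The factor 3 converts code sizes to lengths: [(sz x).+2] is at most 4 * [size x] + 3, which is
   below the cube of [(size x).+2]. *)
exists (code_tm (compile 0 (Seq read_input (Seq p write_output)))), (3 * j) => x.
have rp' := rp x [::]; rewrite !cats0 in rp'.
have [t lt e] := run_seq (run_read_input x) (run_seq rp' (run_write_output (f x))).
apply: computes_within_leq (exec_computes e _) => //.
apply: leq_trans lt _; apply: leq_trans (leq_trans (hj x) _).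
  have h1 : size x <= sz x by apply: ltnW (size_leq_sz x).
  have h2 : size (f x) <= sz (f x) by apply: ltnW (size_leq_sz (f x)).
  by lia.
rewrite expnM; case: (j) => // j'; rewrite leq_exp2r //.
have := sz_bits x; rewrite !expnS expn0; nia.
Qed.

(** If each step adds an amount independent of the accumulator, the total growth is at most the
    length of the list times the largest such amount, hence polynomial. *)
Lemma PT_foldl {A B C : encType} (b0 : B)
    (f : A -> C -> B -> C) (z : A -> C) (l : A -> seq B) (g : A * B -> nat) :
  PT (fun p : A * C * B => f p.1.1 p.1.2 p.2) -> PT z -> PT l -> PB g ->
  (forall a c b, sz (f a c b) <= sz c + g (a, b)) ->
  PT (fun a => foldl (f a) (z a) (l a)).
Proof.
move=> hf hz hl [k hk] le.
pose G a := (sz a + sz (l a)).+3 ^ k.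
apply: (PT_foldl_bounded b0 (bound := fun a => sz (z a) + sz (l a) * G a)) => //.
  apply: PB_add (PT_sz hz) (PB_mul (PT_sz hl) (PB_exp _ _)).
  apply: PB_leq (PB_add (PB_const 3) (PB_add PB_sz (PT_sz hl))) => a; lia.
move=> a l1 l2 e; have leG l3 b l4 : l a = l3 ++ b :: l4 -> g (a, b) <= G a.
  move=> e'; apply: leq_trans (hk _) _; rewrite /G.
  have : sz (a, b) <= (sz a + sz (l a)).+1.
    by have := sz_cat l3 (b :: l4); rewrite sz_pair /= e' sz_cons; have := sz_gt0 l3; lia.
  by case: (k) => // k' ?; rewrite leq_exp2r.
apply: (@leq_trans (sz (z a) + size l1 * G a)).
  elim/last_ind: l1 l2 e => [|l1 b IH] l2 e; first by rewrite addn0.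
  rewrite foldl_rcons size_rcons mulSn; apply: leq_trans (le _ _ _) _.
  rewrite cat_rcons in e; have := IH _ e; have := leG _ _ _ e; lia.
rewrite leq_add2l leq_mul2r; apply/orP; right; apply: ltnW.
by apply: leq_trans (size_leq_sz _); rewrite e size_cat; lia.
Qed.

(** * Unary arithmetic and list functions *)

Lemma toT_nseq n : toT (nseq n tt) = toT n.
Proof. by elim: n => //= n; rewrite /toT /= => ->. Qed.

Lemma iter_foldl {T} n (h : T -> T) x :
  iter n h x = foldl (fun c _ => h c) x (nseq n tt).
Proof. by elim: n x => //= n IH x; rewrite -IH -iterSr. Qed.

Section Arithmetic.
Context {A : encType}.
Implicit Types f g : A -> nat.

Lemma PT_nseq f : PT f -> PT (fun a => nseq (f a) tt).
Proof. by apply: PT_ext => a; rewrite toT_nseq. Qed.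

Lemma PT_succ f : PT f -> PT (fun a => (f a).+1).
Proof. by move=> hf; apply: PT_ext (PT_pair (PT_const tt) hf). Qed.

Lemma PT_pred f : PT f -> PT (fun a => (f a).-1).
Proof.
move/PT_nseq/PT_behead; apply: PT_ext => a.
by rewrite -toT_nseq; case: (f a).
Qed.

Lemma PT_gt0 f : PT f -> PT (fun a => 0 < f a).
Proof.
by move/PT_nseq/PT_cons_p; apply: PT_ext => a; case: (f a).
Qed.

Lemma PT_neg (f : A -> bool) : PT f -> PT (fun a => ~~ f a).
Proof.
move=> hf; have := PT_if hf (PT_const false) (PT_const true).
by apply: PT_ext => a; case: (f a).
Qed.

Lemma PT_and (f g : A -> bool) : PT f -> PT g -> PT (fun a => f a && g a).
Proof. by move=> hf hg; apply: (PT_if hf hg (PT_const false)). Qed.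

Lemma PT_or (f g : A -> bool) : PT f -> PT g -> PT (fun a => f a || g a).
Proof. by move=> hf hg; apply: (PT_if hf (PT_const true) hg). Qed.

Lemma PT_nat_of_bool (f : A -> bool) : PT f -> PT (fun a => nat_of_bool (f a)).
Proof. by move=> hf; apply: (PT_if hf (PT_const 1) (PT_const 0)). Qed.

End Arithmetic.

Section BoundedArithmetic.
Context {A : encType}.
Implicit Types f g : A -> nat.

Lemma PT_iter {B : encType} (h : A -> B -> B) (n : A -> nat) (z : A -> B)
    (bound : A -> nat) :
  PT (fun p : A * B => h p.1 p.2) -> PT n -> PT z -> PB bound ->
  (forall a i, i <= n a -> sz (iter i (h a) (z a)) <= bound a) ->
  PT (fun a => iter (n a) (h a) (z a)).
Proof.
move=> hh hn hz hb le.
have : PT (fun a => foldl (fun c _ => h a c) (z a) (nseq (n a) tt)).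
  apply: (PT_foldl_bounded tt (f := fun a c _ => h a c)) hz (PT_nseq hn) hb _.
    apply: (PT_comp (f := fun p => p.1) hh); exact: PT_fst PT_id.
  move=> a l1 l2 e; have -> : l1 = nseq (size l1) tt.
    by elim: (l1) => //= -[] l /= <-.
  rewrite -iter_foldl; apply: le.
  by move/(congr1 size): e; rewrite size_nseq size_cat; lia.
by apply: PT_ext => a; rewrite iter_foldl.
Qed.

Lemma PT_addn f g : PT f -> PT g -> PT (fun a => f a + g a).
Proof.
move=> hf hg.
have : PT (fun a => iter (g a) succn (f a)).
  apply: (PT_iter (h := fun _ => succn)) hg hf (PB_add (PT_sz hf) (PT_sz hg)) _.
    by apply: PT_succ; apply: PT_snd PT_id.
  by move=> a i le; rewrite iter_succn !sz_nat; lia.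
by apply: PT_ext => a; rewrite iter_succn addnC.
Qed.

Lemma PT_subn f g : PT f -> PT g -> PT (fun a => f a - g a).
Proof.
move=> hf hg.
have : PT (fun a => iter (g a) predn (f a)).
  apply: (PT_iter (h := fun _ => predn)) hg hf (PT_sz hf) _.
    by apply: PT_pred; apply: PT_snd PT_id.
  by move=> a i le; rewrite iter_predn !sz_nat; lia.
by apply: PT_ext => a; rewrite iter_predn.
Qed.

Lemma PT_leq f g : PT f -> PT g -> PT (fun a => f a <= g a).
Proof.
move=> hf hg; apply: PT_ext (PT_neg (PT_gt0 (PT_subn hf hg))) => a.
by rewrite -leqNgt leqn0.
Qed.

Lemma PT_eqn f g : PT f -> PT g -> PT (fun a => f a == g a).
Proof.
move=> hf hg; apply: PT_ext (PT_and (PT_leq hf hg) (PT_leq hg hf)) => a.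
by rewrite eqn_leq.
Qed.

Lemma PT_minn f g : PT f -> PT g -> PT (fun a => minn (f a) (g a)).
Proof. by move=> hf hg; apply: (PT_if (PT_leq (PT_succ hf) hg) hf hg). Qed.

End BoundedArithmetic.

Section Lists.
Context {A B C : encType}.

Lemma PT_catrev (f g : A -> seq B) (b0 : B) :
  PT f -> PT g -> PT (fun a => catrev (f a) (g a)).
Proof.
move=> hf hg.
have : PT (fun a => foldl (fun c b => b :: c) (g a) (f a)).
  apply: (PT_foldl b0 (f := fun _ c b => b :: c)) hg hf (PB_add (PB_const 1) PB_sz) _.
    apply: PT_cons; first exact: PT_snd PT_id.
    apply: PT_snd; exact: PT_fst PT_id.
  by move=> a c b; rewrite sz_cons sz_pair /=; lia.
apply: PT_ext => a; congr toT.
by elim: (f a) (g a) => //= x l IH m; rewrite IH.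
Qed.

Lemma PT_rev (f : A -> seq B) (b0 : B) : PT f -> PT (fun a => rev (f a)).
Proof. by move=> hf; apply: (PT_catrev b0 hf (PT_const [::])). Qed.

End Lists.

Section Traversals.
Context {A B C : encType}.

Lemma PT_cat (f g : A -> seq B) (b0 : B) :
  PT f -> PT g -> PT (fun a => f a ++ g a).
Proof.
move=> hf hg; apply: PT_ext (PT_catrev b0 (PT_rev b0 hf) hg) => a.
by rewrite catrevE revK.
Qed.

Lemma PT_map (h : A -> B -> C) (f : A -> seq B) (b0 : B) (c0 : C) :
  PT (fun p : A * B => h p.1 p.2) -> PT f ->
  PT (fun a => [seq h a b | b <- f a]).
Proof.
move=> hh hf.
have : PT (fun a => foldl (fun c b => h a b :: c) [::] (f a)).
  apply: (PT_foldl b0 (f := fun a c b => h a b :: c) (z := fun _ => [::]))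
    (PT_const _) hf (PB_add (PB_const 1) (PT_sz hh)) _.
    apply: PT_cons; last by apply: PT_snd; apply: PT_fst PT_id.
    apply: (PT_comp (f := fun p => (p.1.1, p.2)) hh).
    by apply: PT_pair; [do 2!apply: PT_fst; apply: PT_id | apply: PT_snd PT_id].
  by move=> a c b; rewrite sz_cons /=; lia.
move/(PT_rev c0); apply: PT_ext => a; congr toT.
have -> : foldl (fun c b => h a b :: c) [::] (f a) = catrev (map (h a) (f a)) [::].
  by elim: (f a) [::] => //= x l IH m; rewrite IH.
by rewrite catrevE cats0 revK.
Qed.

Lemma PT_has (h : A -> B -> bool) (f : A -> seq B) (b0 : B) :
  PT (fun p : A * B => h p.1 p.2) -> PT f -> PT (fun a => has (h a) (f a)).
Proof.
move=> hh hf.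
have : PT (fun a => foldl (fun c b => c || h a b) false (f a)).
  apply: (PT_foldl b0 (f := fun a c b => c || h a b) (z := fun _ => false))
    (PT_const _) hf (PB_const 3) _.
    apply: PT_or; first by apply: PT_snd; apply: PT_fst PT_id.
    apply: (PT_comp (f := fun p => (p.1.1, p.2)) hh).
    by apply: PT_pair; [do 2!apply: PT_fst; apply: PT_id | apply: PT_snd PT_id].
  by move=> a c b; have := sz_bool (c || h a b); lia.
apply: PT_ext => a; congr toT.
transitivity (false || has (h a) (f a)) => //.
by elim: (f a) false => [|x l IH] c /=; rewrite ?orbF // IH orbA.
Qed.

Lemma PT_all (h : A -> B -> bool) (f : A -> seq B) (b0 : B) :
  PT (fun p : A * B => h p.1 p.2) -> PT f -> PT (fun a => all (h a) (f a)).
Proof.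
move=> hh hf.
apply: PT_ext (PT_neg (PT_has (h := fun a b => ~~ h a b) b0 (PT_neg hh) hf)) => a.
by congr toT; elim: (f a) => //= b l <-; rewrite negb_or negbK.
Qed.

Lemma PT_count (h : A -> B -> bool) (f : A -> seq B) (b0 : B) :
  PT (fun p : A * B => h p.1 p.2) -> PT f -> PT (fun a => count (h a) (f a)).
Proof.
move=> hh hf.
have : PT (fun a => foldl (fun c b => c + h a b) 0 (f a)).
  apply: (PT_foldl b0 (f := fun a c b => c + h a b) (z := fun _ => 0))
    (PT_const _) hf (PB_const 3) _.
    apply: PT_addn; first by apply: PT_snd; apply: PT_fst PT_id.
    apply: PT_nat_of_bool; apply: (PT_comp (f := fun p => (p.1.1, p.2)) hh).
    by apply: PT_pair; [do 2!apply: PT_fst; apply: PT_id | apply: PT_snd PT_id].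
  by move=> a c b; rewrite !sz_nat; case: (h a b); lia.
apply: PT_ext => a; congr toT.
rewrite -[RHS]add0n.
by elim: (f a) 0 => [|x l IH] c /=; rewrite ?addn0 // IH addnA.
Qed.

Lemma PT_size (f : A -> seq B) (b0 : B) : PT f -> PT (fun a => size (f a)).
Proof.
move=> hf; apply: PT_ext (PT_count (h := fun _ _ => true) b0 (PT_const _) hf) => a.
by rewrite count_predT.
Qed.

Lemma PT_nth d (f : A -> seq B) (n : A -> nat) :
  PT f -> PT n -> PT (fun a => nth d (f a) (n a)).
Proof.
move=> hf hn.
have : PT (fun a => iter (n a) behead (f a)).
  apply: (PT_iter (h := fun _ => behead)) hn hf (PT_sz hf) _.
    by apply: PT_behead; apply: PT_snd PT_id.
  move=> a i _; elim: i => //= i; apply: leq_trans.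
  by case: (iter _ _ _) => // x l; rewrite sz_cons /=; lia.
move/(PT_head d); apply: PT_ext => a; congr toT.
rewrite -nth0 -[n a in RHS]addn0; elim: (n a) 0 => //= i IH j.
by rewrite nth_behead IH addnS.
Qed.

End Traversals.

Lemma PT_flatten {A B : encType} (f : A -> seq (seq B)) (b0 : B) :
  PT f -> PT (fun a => flatten (f a)).
Proof.
move=> hf.
have : PT (fun a => foldl cat [::] (f a)).
  apply: (PT_foldl [::] (f := fun a => cat) (z := fun _ => [::]))
    (PT_const _) hf PB_sz _.
    by apply: (PT_cat b0); [apply: PT_snd; apply: PT_fst PT_id | apply: PT_snd PT_id].
  by move=> a c b; have := sz_cat c b; rewrite sz_pair /=; lia.
apply: PT_ext => a; congr toT.
transitivity ([::] ++ flatten (f a)) => //.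
by elim: (f a) [::] => [|x l IH] c /=; rewrite ?cats0 // IH catA.
Qed.

Lemma sz_iota k : sz (iota 0 k) <= k * (k.*2 + 3) + 1.
Proof.
have : forall m j, m + j <= k -> sz (iota m j) <= j * (k.*2 + 3) + 1.
  move=> m j; elim: j m => // j IH m le; have := IH m.+1.
  by rewrite /= sz_cons sz_nat mulSn; lia.
exact.
Qed.

Lemma PT_iota {A : encType} (n : A -> nat) : PT n -> PT (fun a => iota 0 (n a)).
Proof.
move=> hn.
have it k : iter k (fun c => 0 :: map succn c) [::] = iota 0 k.
  elim: k => //= k ->; congr cons; rewrite -[1]addn1 addnC iotaDl.
  by apply: eq_map => i; rewrite add1n.
have hb : PB (fun a => n a * ((n a).*2 + 3) + 1).
  apply: PB_leq (PB_add (PB_mul (PT_sz hn) (PB_add (PT_sz hn) (PB_const 3)))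
    (PB_const 1)) => a.
  by rewrite sz_nat; nia.
have : PT (fun a => iter (n a) (fun c => 0 :: map succn c) [::]).
  apply: (PT_iter (h := fun _ c => 0 :: map succn c) (z := fun _ => [::]))
    hn (PT_const _) hb _.
    apply: (PT_cons (f := fun _ => 0)); first exact: PT_const.
    by apply: (PT_map (h := fun _ => succn) 0 0);
       [apply: PT_succ; apply: PT_snd PT_id | apply: PT_snd PT_id].
  by move=> a i le; rewrite it; apply: leq_trans (sz_iota i) _; nia.
by apply: PT_ext => a; rewrite it.
Qed.

Lemma PT_mkseq {A B : encType} (h : A -> nat -> B) (n : A -> nat) (b0 : B) :
  PT (fun p : A * nat => h p.1 p.2) -> PT n -> PT (fun a => mkseq (h a) (n a)).
Proof. by move=> hh hn; apply: (PT_map 0 b0 hh (PT_iota hn)). Qed.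

(** * The verifier and the reduction as functions on words *)

Ltac default_elt :=
  first [exact false | exact 0 | exact [::] | exact tt | exact (false, false)].

(** Syntax-directed: second-order patterns recognize the operation under the binder and supply its
    arguments to the closure lemma, and any other goal is tried as a case distinction. Calls that no
    pattern covers must have their [PT] fact in the context. *)
Ltac pt_step :=
  cbv beta;
  lazymatch goal with
  | |- PT (fun x => x) => exact: PT_id
  | |- PT (fun _ => ?c) => exact: PT_const
  | |- PT fst => exact: (PT_fst PT_id)
  | |- PT snd => exact: (PT_snd PT_id)
  | |- PT (fun x => (@?f x, @?g x)) => apply: (PT_pair (f := f) (g := g))
  | |- PT (fun x => fst (@?f x)) => apply: (PT_fst (f := f))
  | |- PT (fun x => snd (@?f x)) => apply: (PT_snd (f := f))
  | |- PT (fun x => negb (@?f x)) => apply: (PT_neg (f := f))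
  | |- PT (fun x => andb (@?f x) (@?g x)) => apply: (PT_and (f := f) (g := g))
  | |- PT (fun x => orb (@?f x) (@?g x)) => apply: (PT_or (f := f) (g := g))
  | |- PT (fun x => nat_of_bool (@?f x)) => apply: (PT_nat_of_bool (f := f))
  | |- PT (fun x => cons (@?f x) (@?g x)) => apply: (PT_cons (f := f) (g := g))
  | |- PT (fun x => behead (@?f x)) => apply: (PT_behead (f := f))
  | |- PT (fun x => head _ (@?f x)) => apply: (PT_head _ (f := f))
  | |- PT (fun x => nth _ (@?f x) (@?g x)) => apply: (PT_nth _ (f := f) (n := g))
  | |- PT (fun x => S (@?f x)) => apply: (PT_succ (f := f))
  | |- PT (fun x => Nat.pred (@?f x)) => apply: (PT_pred (f := f))
  | |- PT (fun x => addn (@?f x) (@?g x)) => apply: (PT_addn (f := f) (g := g))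
  | |- PT (fun x => subn (@?f x) (@?g x)) => apply: (PT_subn (f := f) (g := g))
  | |- PT (fun x => minn (@?f x) (@?g x)) => apply: (PT_minn (f := f) (g := g))
  | |- PT (fun x => leq (@?f x) (@?g x)) => apply: (PT_leq (f := f) (g := g))
  | |- PT (fun x => eq_op (@?f x) (@?g x)) => apply: (PT_eqn (f := f) (g := g))
  | |- PT (fun x => rev (@?f x)) => apply: (PT_rev (f := f)); [default_elt|]
  | |- PT (fun x => cat (@?f x) (@?g x)) =>
      apply: (PT_cat (f := f) (g := g)); [default_elt| |]
  | |- PT (fun x => flatten (@?f x)) => apply: (PT_flatten (f := f)); [default_elt|]
  | |- PT (fun x => size (@?f x)) => apply: (PT_size (f := f)); [default_elt|]
  | |- PT (fun x => iota 0 (@?f x)) => apply: (PT_iota (n := f))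
  | |- PT (fun x => map (@?h x) (@?f x)) =>
      apply: (PT_map (h := h) (f := f)); [default_elt|default_elt| |]
  | |- PT (fun x => mkseq (@?h x) (@?f x)) =>
      apply: (PT_mkseq (h := h) (n := f)); [default_elt| |]
  | |- PT (fun x => has (@?h x) (@?f x)) =>
      apply: (PT_has (h := h) (f := f)); [default_elt| |]
  | |- PT (fun x => all (@?h x) (@?f x)) =>
      apply: (PT_all (h := h) (f := f)); [default_elt| |]
  | |- PT (fun x => count (@?h x) (@?f x)) =>
      apply: (PT_count (h := h) (f := f)); [default_elt| |]
  | |- PT _ => apply: PT_if
  end.

Ltac pt := repeat (first [assumption | pt_step]).

(* State: whether the next bit is a payload bit, the current word and the
   finished words, all reversed. *)
Definition dec_step (s : bool * (bits * seq bits)) (b : bool) :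
    bool * (bits * seq bits) :=
  if s.1 then (false, (b :: s.2.1, s.2.2))
  else if b then (true, s.2) else (false, ([::], s.2.1 :: s.2.2)).

Definition dec (x : bits) : seq bits :=
  rev [seq rev w | w <- (foldl dec_step (false, ([::], [::])) x).2.2].

Lemma decK ws : dec (enc_seq ws) = ws.
Proof.
have H w rest : forall cur acc, foldl dec_step (false, (cur, acc)) (enc_word w ++ rest) =
    foldl dec_step (false, ([::], catrev w cur :: acc)) rest.
  by elim: w => [|b w IH] cur acc //=; rewrite [LHS]IH.
rewrite /dec /enc_seq.
have -> acc : foldl dec_step (false, ([::], acc)) (flatten (map enc_word ws)) =
  (false, ([::], catrev (map rev ws) acc)).
  by elim: ws acc => //= w ws IH acc; rewrite H IH.
by rewrite /= catrevE cats0 map_rev revK -map_comp map_id_in // => w _ /=; rewrite revK.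
Qed.

Lemma PT_dec {A : encType} (f : A -> bits) : PT f -> PT (fun a => dec (f a)).
Proof.
move=> hf; rewrite /dec; do 2!pt_step; try by pt.
apply: PT_snd; apply: PT_snd.
apply: (PT_foldl false (f := fun _ => dec_step) (z := fun _ => (false, ([::], [::]))))
  (PT_const _) hf (PB_const 20) _.
  by rewrite /dec_step; pt.
move=> a [c [cur acc]] b; rewrite /dec_step /=.
by case: c => /=; case: b => /=; rewrite !sz_pair /= ?sz_cons ?sz_pair /= /sz /=; lia.
Qed.

(* Compares [c * den] with [num] by Horner's rule from the most significant
   bit: the state is 0 if the difference [num - c * den] of the prefixes is
   negative, as it then stays so, and [(minn c difference).+1] otherwise, since
   a difference of at least [c] can no longer become negative. *)
Definition horner_step (c acc : nat) (bd : bool * bool) : nat :=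
  if 0 < acc then
    if (if bd.2 then c else 0) <= acc.-1 + acc.-1 + bd.1 then
      (minn c (acc.-1 + acc.-1 + bd.1 - (if bd.2 then c else 0))).+1
    else 0
  else 0.

(** Only [c], a number of edges, is unary. The words are padded to a common length by the default of
    [nth], and the initial accumulator 1 stands for the difference 0. *)
Definition scaled_leq (c : nat) (den num : bits) : bool :=
  0 < foldl (horner_step c) 1
    (rev (mkseq (fun i => (nth false num i, nth false den i))
                (size num + size den))).

Definition bval (w : bits) : nat := foldr (fun (b : bool) v => b + v.*2) 0 w.

Lemma bval_mkseq w m : size w <= m -> bval (mkseq (nth false w) m) = bval w.
Proof.
rewrite /mkseq; elim: m w => [|m IH] w le; first by case: w le.
have e : [seq nth false w i | i <- iota 1 m] =
         [seq nth false (behead w) i | i <- iota 0 m].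
  rewrite -[1]addn0 iotaDl -map_comp; apply: eq_map => i /=.
  by rewrite nth_behead.
rewrite /= e IH ?size_behead; last by lia.
by case: w {e le}.
Qed.

Lemma scaled_leqE c den num : scaled_leq c den num = (c * bval den <= bval num).
Proof.
pose N (L : seq (bool * bool)) := bval (unzip1 L).
pose D (L : seq (bool * bool)) := bval (unzip2 L).
(* [foldr] meets the most significant pair first, so a suffix [L] is what has been processed so
   far. *)
have H L : foldr (fun bd acc => horner_step c acc bd) 1 L =
    if c * D L <= N L then (minn c (N L - c * D L)).+1 else 0.
  elim: L => [|[b d] L IH]; first by rewrite /= muln0 subn0 minn0.
  rewrite /= {}IH /N /D /= -/(N L) -/(D L).
  move: (N L) (D L) => n k; rewrite /horner_step /=.
  have -> : c * (d + k.*2) = (if d then c else 0) + (c * k).*2 by case: d; lia.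
  by move: (c * k) => ck; case: (leqP ck n) => /= h; case: d => /=; case: b => /=;
     do ![case: leqP => /= ?]; lia.
rewrite /scaled_leq foldl_rev H /N /D.
have -> : unzip1 (mkseq (fun i => (nth false num i, nth false den i))
    (size num + size den)) =
  mkseq (nth false num) (size num + size den) by rewrite /unzip1 /mkseq -map_comp.
have -> : unzip2 (mkseq (fun i => (nth false num i, nth false den i))
    (size num + size den)) =
  mkseq (nth false den) (size num + size den) by rewrite /unzip2 /mkseq -map_comp.
by rewrite !bval_mkseq ?leq_addr ?leq_addl //; case: ifP.
Qed.

Lemma PT_scaled_leq {A : encType} (c : A -> nat) (den num : A -> bits) :
  PT c -> PT den -> PT num -> PT (fun a => scaled_leq (c a) (den a) (num a)).
Proof.
move=> hc hd hn; rewrite /scaled_leq; apply: PT_gt0.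
(* Thanks to the cap in [horner_step] the unary accumulator never exceeds [c a + 1]. *)
apply: (PT_foldl_bounded (false, false) (f := fun a => horner_step (c a))
   (z := fun _ => 1) (bound := fun a => sz (c a) + 3)).
- have hc' : PT (fun p : A * nat * (bool * bool) => c p.1.1).
    by apply: (PT_comp hc); pt.
  rewrite /horner_step.
  by pt.
- exact: PT_const.
- have hd' : PT (fun p : A * nat => den p.1) by apply: (PT_comp hd); pt.
  have hn' : PT (fun p : A * nat => num p.1) by apply: (PT_comp hn); pt.
  by pt.
- exact: PB_add (PT_sz hc) (PB_const _).
- move=> a l1 _ _; elim/last_ind: l1 => [|l bd _]; first by rewrite /= !sz_nat; lia.
  rewrite foldl_rcons !sz_nat.
  apply: (@leq_trans (c a).+1.*2.+1); last by rewrite doubleS; move: (c a) => k; lia.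
  rewrite ltnS leq_double.
  move: (foldl _ _ _) => acc; rewrite /horner_step; case: ifP => // _.
  case: bd => b [] /=; rewrite ?ltnS ?geq_minl //; case: ifP => // _.
  by rewrite ltnS geq_minl.
Qed.

(** * Connectivity of a community, on words *)

Definition expand (n : nat) (E : seq bits) (C R : bits) : bits :=
  mkseq (fun j => nth false C j && (nth false R j ||
    has (fun i => nth false R i &&
           (nth false (nth [::] E i) j || nth false (nth [::] E j) i))
        (iota 0 n))) n.

Definition reach (n : nat) (E : seq bits) (C : bits) (r : nat) : bits :=
  iter n (expand n E C) (mkseq (fun j => j == r) n).

Definition connected_from (n : nat) (E : seq bits) (C : bits) (r : nat) : bool :=
  nth false C r &&
  all (fun j => ~~ nth false C j || nth false (reach n E C r) j) (iota 0 n).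

(** The search for a root inside [C] makes the test fail on the empty community, as
    [induced_connected] demands. *)
Definition connected_word (n : nat) (E : seq bits) (C : bits) : bool :=
  has (connected_from n E C) (iota 0 n).

Lemma PT_expand {A : encType} (n : A -> nat) (E : A -> seq bits)
    (C R : A -> bits) :
  PT n -> PT E -> PT C -> PT R ->
  PT (fun a => expand (n a) (E a) (C a) (R a)).
Proof.
move=> hn hE hC hR; rewrite /expand.
have h1 : PT (fun p : A * nat => n p.1) by apply: (PT_comp hn); pt.
have h2 : PT (fun p : A * nat => C p.1) by apply: (PT_comp hC); pt.
have h3 : PT (fun p : A * nat => R p.1) by apply: (PT_comp hR); pt.
have h4 : PT (fun p : A * nat * nat => R p.1.1) by apply: (PT_comp hR); pt.
have h5 : PT (fun p : A * nat * nat => E p.1.1) by apply: (PT_comp hE); pt.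
by pt.
Qed.

Lemma sz_mkseq_bits (h : nat -> bool) n : sz (mkseq h n) <= 4 * n + 1.
Proof. by apply: leq_trans (sz_bits _) _; rewrite size_mkseq. Qed.

Lemma PT_reach {A : encType} (n : A -> nat) (E : A -> seq bits)
    (C : A -> bits) (r : A -> nat) :
  PT n -> PT E -> PT C -> PT r ->
  PT (fun a => reach (n a) (E a) (C a) (r a)).
Proof.
move=> hn hE hC hr; rewrite /reach.
apply: (PT_iter (h := fun a => expand (n a) (E a) (C a))
   (z := fun a => mkseq (fun j => j == r a) (n a))
   (bound := fun a => 4 * sz (n a) + 1)) => //.
- by apply: PT_expand;
    [apply: (PT_comp hn) | apply: (PT_comp hE) | apply: (PT_comp hC) |]; pt.
- by have h1 : PT (fun p : A * nat => r p.1) by [apply: (PT_comp hr); pt]; pt.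
- exact: PB_add (PB_mul (PB_const _) (PT_sz hn)) (PB_const _).
- by move=> a [|i] _; apply: leq_trans (sz_mkseq_bits _ _) _; rewrite sz_nat; lia.
Qed.

Lemma PT_connected_word {A : encType} (n : A -> nat) (E : A -> seq bits)
    (C : A -> bits) :
  PT n -> PT E -> PT C -> PT (fun a => connected_word (n a) (E a) (C a)).
Proof.
move=> hn hE hC; rewrite /connected_word /connected_from.
have h1 : PT (fun p : A * nat => n p.1) by apply: (PT_comp hn); pt.
have h2 : PT (fun p : A * nat => C p.1) by apply: (PT_comp hC); pt.
have h3 : PT (fun p : A * nat * nat => C p.1.1) by apply: (PT_comp hC); pt.
have h4 : PT (fun p : A * nat * nat => reach (n p.1.1) (E p.1.1) (C p.1.1) p.1.2).
  by apply: PT_reach; [apply: (PT_comp hn) | apply: (PT_comp hE) | |]; pt.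
by pt.
Qed.

(** * The verifier *)

Definition graph_rows (x : bits) : seq bits :=
  dec (nth [::] (dec (nth [::] (dec x) 0)) 0).
Definition community_words (x : bits) : seq bits :=
  dec (nth [::] (dec (nth [::] (dec x) 0)) 1).
Definition bound_word (x : bits) : bits :=
  nth [::] (dec (nth [::] (dec x) 0)) 2.
Definition budget_words (x : bits) : seq bits :=
  dec (nth [::] (dec (nth [::] (dec x) 0)) 3).
Definition witness_rows (x : bits) : seq bits :=
  dec (nth [::] (dec x) 1).

(** The conjunction confines an arbitrary certificate to edges of the graph. The result need not be
    symmetric; [expand] reads an entry in either order as an edge. *)
Definition chosen_matrix (G M : seq bits) : seq bits :=
  mkseq (fun i => mkseq (fun j =>
    nth false (nth [::] G i) j && nth false (nth [::] M i) j) (size G)) (size G).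

(** [head] and [behead] separate sign and absolute value of an integer, and [[:: true]] is the
    denominator 1. The count of matrix entries is an upper bound on the number of chosen edges, with
    equality if no edge is marked in both orders. *)
Definition nws_check (G Cs : seq bits) (l : bits) (b M : seq bits) : bool :=
  [&& ~~ head true l,
      scaled_leq (count id (flatten (chosen_matrix G M))) [:: true] (behead l),
      scaled_leq (count id (flatten (chosen_matrix G M)))
        (behead (nth [::] b 1)) (behead (nth [::] b 0)) &
      all (connected_word (size G) (chosen_matrix G M)) Cs].

Definition nws_verifier (x : bits) : bits :=
  [:: nws_check (graph_rows x) (community_words x) (bound_word x)
        (budget_words x) (witness_rows x)].

Lemma PT_chosen_matrix {A : encType} (G M : A -> seq bits) :
  PT G -> PT M -> PT (fun a => chosen_matrix (G a) (M a)).
Proof.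
move=> hG hM; rewrite /chosen_matrix.
have h1 : PT (fun p : A * nat => G p.1) by apply: (PT_comp hG); pt.
have h2 : PT (fun p : A * nat * nat => G p.1.1) by apply: (PT_comp hG); pt.
have h3 : PT (fun p : A * nat * nat => M p.1.1) by apply: (PT_comp hM); pt.
by pt.
Qed.

Lemma polytime_nws_verifier : polytime nws_verifier.
Proof.
apply: polytime_of_PT; rewrite /nws_verifier /nws_check.
have hx := @PT_id (seq_encType bool_encType).
have hI i : PT (fun x : bits => nth [::] (dec (nth [::] (dec x) 0)) i).
  apply: PT_nth (PT_const _); apply: PT_dec.
  by apply: PT_nth (PT_const _); apply: PT_dec.
have hG : PT graph_rows by apply: PT_dec.
have hC : PT community_words by apply: PT_dec.
have hb : PT budget_words by apply: PT_dec.
have hl : PT bound_word by exact: (hI 2).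
have hW : PT witness_rows.
  by apply: PT_dec; apply: PT_nth (PT_const _); apply: PT_dec.
have hM : PT (fun x => chosen_matrix (graph_rows x) (witness_rows x)).
  exact: PT_chosen_matrix.
have hc : PT (fun x =>
    count id (flatten (chosen_matrix (graph_rows x) (witness_rows x)))).
  by pt.
have s1 : PT (fun x => scaled_leq
    (count id (flatten (chosen_matrix (graph_rows x) (witness_rows x))))
    [:: true] (behead (bound_word x))).
  by apply: PT_scaled_leq => //; pt.
have s2 : PT (fun x => scaled_leq
    (count id (flatten (chosen_matrix (graph_rows x) (witness_rows x))))
    (behead (nth [::] (budget_words x) 1)) (behead (nth [::] (budget_words x) 0))).
  by apply: PT_scaled_leq => //; pt.
have hconn : PT (fun p : bits * bits => connected_word (size (graph_rows p.1))
    (chosen_matrix (graph_rows p.1) (witness_rows p.1)) p.2).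
  apply: PT_connected_word; last by pt.
    by apply: (PT_size [::]); apply: (PT_comp hG); pt.
  by apply: (PT_comp hM); pt.
by pt.
Qed.

(** * Binary increment and the reduction on words *)

Definition inc_step (s : bool * bits) (b : bool) : bool * bits :=
  if s.1 then (if b then (true, false :: s.2) else (false, true :: s.2))
  else (false, b :: s.2).

(** The state is the carry with the digits produced so far, reversed; a final carry becomes a new
    leading digit. Iterating this turns unary numbers into binary ones. *)
Definition inc_word (w : bits) : bits :=
  rev (if (foldl inc_step (true, [::]) w).1
       then true :: (foldl inc_step (true, [::]) w).2
       else (foldl inc_step (true, [::]) w).2).

Lemma inc_enc_nat n : inc_word (enc_nat n) = enc_nat n.+1.
Proof.
pose fin (s : bool * bits) := rev (if s.1 then true :: s.2 else s.2).
have F0 w acc : fin (foldl inc_step (false, acc) w) = catrev acc w.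
  elim: w acc => //= b w IH acc; exact: IH.
have F1 p acc : fin (foldl inc_step (true, acc) (enc_pos p)) =
    catrev acc (enc_pos (PosDef.Pos.succ p)).
  elim: p acc => [p IH|p IH|] acc //=; first exact: IH.
  exact: F0.
rewrite /inc_word -/(fin _) /enc_nat.
have -> : bin_of_nat n.+1 =
    BinNums.Npos (if bin_of_nat n is BinNums.Npos p then PosDef.Pos.succ p
                  else BinNums.xH).
  apply: (can_inj nat_of_binK); rewrite bin_of_natK -{1}(bin_of_natK n).
  by case: (bin_of_nat n) => //= p; rewrite nat_of_succ_pos.
by case: (bin_of_nat n) => //= p; rewrite F1.
Qed.

Lemma PT_inc_word {A : encType} (f : A -> bits) :
  PT f -> PT (fun a => inc_word (f a)).
Proof.
move=> hf; have h : PT (fun a => foldl inc_step (true, [::]) (f a)).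
  apply: (PT_foldl false (f := fun _ => inc_step) (z := fun _ => (true, [::])))
    (PT_const _) hf (PB_const 20) _.
    by rewrite /inc_step; pt.
  move=> a [c w] b; rewrite /inc_step /=.
  by case: c => /=; case: b => /=; rewrite !sz_pair /= ?sz_cons /sz /=; lia.
by rewrite /inc_word; pt.
Qed.

Lemma sz_enc_nat n : sz (enc_nat n) <= 4 * n + 1.
Proof.
apply: leq_trans (sz_bits _) _; rewrite leq_add2r leq_mul2l /=.
elim: n => // n IH; rewrite -inc_enc_nat.
apply: leq_trans (_ : (size (enc_nat n)).+1 <= _) => //.
rewrite /inc_word size_rev.
have : forall w s, size (foldl inc_step s w).2 = size w + size s.2.
  move=> w; elim: w => //= b w IH' s; rewrite IH' /inc_step.
  by case: s.1; case: b; rewrite /=; lia.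
by move=> H; case: ifP => _ /=; rewrite H /=; lia.
Qed.

Lemma PT_enc_nat {A : encType} (n : A -> nat) :
  PT n -> PT (fun a => enc_nat (n a)).
Proof.
move=> hn; have it k : iter k inc_word [::] = enc_nat k.
  by elim: k => // k IH; rewrite iterS IH inc_enc_nat.
have : PT (fun a => iter (n a) inc_word [::]).
  apply: (PT_iter (h := fun _ => inc_word) (z := fun _ => [::])
    (bound := fun a => 4 * sz (n a) + 1)) (hn) (PT_const _) _ _.
  - by apply: PT_inc_word; pt.
  - exact: PB_add (PB_mul (PB_const _) (PT_sz hn)) (PB_const _).
  - by move=> a i le; rewrite it; apply: leq_trans (sz_enc_nat _) _; rewrite sz_nat; lia.
by apply: PT_ext => a; rewrite it.
Qed.

Lemma PT_enc_word {A : encType} (w : A -> bits) :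
  PT w -> PT (fun a => enc_word (w a)).
Proof. by move=> hw; rewrite /enc_word; pt. Qed.

Lemma PT_enc_seq {A : encType} (ws : A -> seq bits) :
  PT ws -> PT (fun a => enc_seq (ws a)).
Proof.
move=> hws; rewrite /enc_seq; do 2!pt_step; last by [].
by apply: PT_enc_word; pt.
Qed.

(** [[:: false; true]] is the code of the integer 1, and [n] times [false] is the empty
    community. *)
Definition no_instance_word (x : bits) (n : nat) : bits :=
  enc_seq [:: x; enc_seq [:: mkseq (fun _ => false) n]; [:: false; true];
              enc_seq [:: [:: false; true]; [:: false; true]]].

Definition cycle_instance_word (x : bits) (n : nat) : bits :=
  enc_seq [:: x; enc_seq (mkseq (fun i => mkseq (fun j => ~~ (j == i)) n) n);
              false :: enc_nat n;
              enc_seq [:: false :: enc_nat n; [:: false; true]]].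

(** On the code of a graph, [dec x] lists the rows of the adjacency matrix, so its size is the
    number of vertices. *)
Definition reduction_word (x : bits) : bits :=
  if size (dec x) < 3 then no_instance_word x (size (dec x))
  else cycle_instance_word x (size (dec x)).

Lemma polytime_reduction_word : polytime reduction_word.
Proof.
apply: polytime_of_PT; rewrite /reduction_word /no_instance_word /cycle_instance_word.
have hx := @PT_id (seq_encType bool_encType).
have hd : PT dec by apply: PT_dec.
have hn : PT (fun x => size (dec x)) by pt.
have hn' : PT (fun p : bits * nat => size (dec p.1)) by apply: (PT_comp hn); pt.
have he := PT_enc_nat hn.
apply: PT_if; first by pt.
  apply: PT_enc_seq; apply: PT_cons hx _; apply: PT_cons; last by pt.
  by apply: PT_enc_seq; pt.
apply: PT_enc_seq; apply: PT_cons hx _; apply: PT_cons; first by apply: PT_enc_seq; pt.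
apply: PT_cons; first by pt.
by apply: PT_cons (PT_const _); apply: PT_enc_seq; pt.
Qed.

(** * Membership in NP *)

Lemma bval_enc_nat n : bval (enc_nat n) = n.
Proof.
have H p : bval (enc_pos p) = nat_of_pos p.
  by elim: p => [p IH|p IH|] //=; rewrite IH NatTrec.doubleE.
rewrite /enc_nat -{2}(bin_of_natK n).
by case: (bin_of_nat n) => //= p; apply: H.
Qed.

Lemma nth_enc_set n (C : {set 'I_n}) (i : 'I_n) : nth false (enc_set C) i = (i \in C).
Proof.
by rewrite (nth_map i) ?size_enum_ord // nth_ord_enum.
Qed.

Lemma has_iota_ord n (P : nat -> bool) :
  reflect (exists i : 'I_n, P i) (has P (iota 0 n)).
Proof.
apply: (iffP hasP) => [[i]|[i Pi]].
  by rewrite mem_iota => lt Pi; exists (Ordinal lt).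
by exists (val i) => //; rewrite mem_iota ltn_ord.
Qed.

Lemma all_iota_ord n (P : nat -> bool) :
  reflect (forall i : 'I_n, P i) (all P (iota 0 n)).
Proof.
apply: (iffP allP) => [H i|H i]; first by apply: H; rewrite mem_iota ltn_ord.
by rewrite mem_iota => lt; apply: (H (Ordinal lt)).
Qed.

Lemma induced_adj_sym (T : finType) (E : {set {set T}}) C :
  connect_sym (induced_adj E C).
Proof.
apply: sym_connect_sym => x y.
by rewrite /induced_adj /adj setUC andbCA.
Qed.

Lemma induced_connectedP (T : finType) (E : {set {set T}}) (C : {set T}) :
  induced_connected E C <->
  exists2 r, r \in C & {in C, forall x, connect (induced_adj E C) r x}.
Proof.
split=> [[/set0Pn [r rC] conn]|[r rC conn]].
  by exists r => // x xC; apply: conn.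
split=> [|x y xC yC]; first by apply/set0Pn; exists r.
by apply: (connect_trans (y := r)) (conn y yC); rewrite induced_adj_sym conn.
Qed.

Lemma eq_set2 (T : finType) (x y x' y' : T) : [set x; y] = [set x'; y'] ->
  (x = x' /\ y = y') \/ (x = y' /\ y = x').
Proof.
move=> eq; have hx : x \in [set x'; y'] by rewrite -eq set21.
have hy : y \in [set x'; y'] by rewrite -eq set22.
have hx' : x' \in [set x; y] by rewrite eq set21.
have hy' : y' \in [set x; y] by rewrite eq set22.
case/set2P: hx => ?; case/set2P: hy => ?; case/set2P: hx' => ?;
case/set2P: hy' => ?; intuition congruence.
Qed.

Section Reachability.

Variables (n : nat) (E : {set {set 'I_n}}) (C : {set 'I_n}) (M : seq bits).
Hypothesis adjM : forall i j : 'I_n, adj E i j =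
  nth false (nth [::] M i) j || nth false (nth [::] M j) i.

Let e := induced_adj E C.
Let R (r : 'I_n) k := iter k (expand n M (enc_set C)) (mkseq (fun j => j == r) n).

Let R0 r (j : 'I_n) : nth false (R r 0) j = (j == r).
Proof. by rewrite nth_mkseq. Qed.

Let RS r k (j : 'I_n) : nth false (R r k.+1) j =
  (j \in C) && (nth false (R r k) j ||
    [exists i : 'I_n, nth false (R r k) i && adj E i j]).
Proof.
rewrite /R iterS -/(R r k) nth_mkseq // nth_enc_set; congr (_ && (_ || _)).
apply/has_iota_ord/existsP => -[i /andP[Ri ij]]; exists i; rewrite Ri.
  by rewrite adjM.
by rewrite -adjM.
Qed.

Let reach_sound (r j : 'I_n) k : r \in C -> nth false (R r k) j ->
  (j \in C) /\ connect e r j.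
Proof.
move=> rC; elim: k j => [|k IH] j; first by rewrite R0 => /eqP ->.
rewrite RS => /andP[jC /orP[/IH[]|/existsP[i /andP[/IH[iC ri] ij]]]]; split=> //.
by apply: connect_trans ri (connect1 _); rewrite /e /induced_adj iC jC.
Qed.

Let reach_complete (r : 'I_n) p k : r \in C -> path e r p -> size p <= k ->
  nth false (R r k) (last r p).
Proof.
move=> rC; elim: k p => [|k IH] p.
  by case: p => // _ _; rewrite R0.
case/lastP: p => [_ _|p y].
  by rewrite RS rC [nth _ _ _](IH [::]).
rewrite rcons_path last_rcons size_rcons ltnS => /andP[pp /and3P[zC yC zy]] le.
rewrite RS yC; apply/orP; right; apply/existsP; exists (last r p).
by rewrite IH.
Qed.

Lemma connected_wordP :
  connected_word n M (enc_set C) <-> induced_connected E C.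
Proof.
rewrite induced_connectedP; split.
  move=> /has_iota_ord [r /andP[]]; rewrite nth_enc_set => rC /all_iota_ord conn.
  exists r => // x xC; have := conn x; rewrite nth_enc_set xC /=.
  by case/(reach_sound rC).
move=> [r rC conn]; apply/has_iota_ord; exists r.
rewrite /connected_from nth_enc_set rC; apply/all_iota_ord => j.
rewrite nth_enc_set; case: (boolP (j \in C)) => //= jC.
have /connectP[p pp ->] := conn j jC.
(* A path without repetitions has fewer than [n] edges, so [n] rounds reach its end. *)
case/shortenP: pp => q pq uq _; apply: reach_complete => //.
move/card_uniqP: uq => /= uq; have := max_card (mem (r :: q)).
by rewrite uq card_ord; lia.
Qed.

End Reachability.

Lemma count_flatten_mkseq n (m : nat -> nat -> bool) :
  count id (flatten (mkseq (fun i => mkseq (m i) n) n)) =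
  #|[set p : 'I_n * 'I_n | m p.1 p.2]|.
Proof.
have ei : iota 0 n = index_iota 0 n by rewrite /index_iota subn0.
rewrite count_flatten /mkseq -map_comp sumnE big_map ei big_mkord.
under eq_bigr => i _ do
  rewrite /= -sumn_count sumnE 2!big_map big_mkord.
rewrite pair_big /= -sum1_card [RHS]big_mkcond /=.
by apply: eq_bigr => p _; rewrite inE; case: (m _ _).
Qed.

Lemma leq_budget (c : nat) (b : rat) : (0 < b)%R ->
  (c%:R <= b)%R = (c * `|denq b| <= `|numq b|)%N.
Proof.
move=> b0; rewrite -{1}(divq_num_den b) ler_pdivlMr ?ltr0z ?denq_gt0 //.
have n0 : (0 < numq b)%R by rewrite numq_gt0.
have := denq_gt0 b; rewrite -[(c%:R)%R]/((c%:Z)%:~R)%R -intrM ler_int.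
by move: (denq b) (numq b) n0 => d m; lia.
Qed.

Definition rows n (a : 'I_n -> 'I_n -> bool) : seq bits :=
  [seq [seq a i j | j <- enum 'I_n] | i <- enum 'I_n].

Lemma size_rows n (a : 'I_n -> 'I_n -> bool) : size (rows a) = n.
Proof. by rewrite size_map size_enum_ord. Qed.

Lemma nth_rows n (a : 'I_n -> 'I_n -> bool) (i j : 'I_n) :
  nth false (nth [::] (rows a) i) j = a i j.
Proof.
by do 2!rewrite (nth_map i) ?size_enum_ord // nth_ord_enum.
Qed.

Lemma size_enc_word w : size (enc_word w) = (size w).*2.+1.
Proof.
by rewrite /enc_word size_cat /= addn1; elim: w => //= b w ->.
Qed.

Lemma size_enc_rows n (a : 'I_n -> 'I_n -> bool) :
  size (enc_seq (rows a)) = n * n.*2.+1.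
Proof.
rewrite /enc_seq /rows -map_comp.
have H s : size (flatten [seq (enc_word \o (fun i => [seq a i j | j <- enum 'I_n])) i
    | i <- s]) = size s * n.*2.+1.
  elim: s => //= i s IH; rewrite size_cat IH size_enc_word.
  by rewrite size_map size_enum_ord mulSn.
by rewrite H size_enum_ord.
Qed.

Lemma nth_chosen_matrix n (a : 'I_n -> 'I_n -> bool) M (i j : 'I_n) :
  nth false (nth [::] (chosen_matrix (rows a) M) i) j =
  a i j && nth false (nth [::] M i) j.
Proof. by rewrite nth_mkseq ?size_rows // nth_mkseq // nth_rows. Qed.

Lemma nws_verifierP (I : unweighted_nws_instance) (u : bits) :
  let G := nws_graph I in
  let m (i j : vertex G) := adj (edges G) i j && nth false (nth [::] (dec u) i) j in
  let c := #|[set p : vertex G * vertex G | m p.1 p.2]| in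
  (0 < budget I)%R ->
  nws_verifier (enc_seq [:: enc_unweighted_nws I; u]) = [:: true] <->
  [/\ (c%:Z <= edge_bound I)%R, (c%:R <= budget I)%R &
      forall C, C \in communities I ->
        connected_word (Defs.order G) (chosen_matrix (rows (adj (edges G))) (dec u))
          (enc_set C)].
Proof.
move=> G m c b0.
rewrite /nws_verifier /graph_rows /community_words /bound_word /budget_words.
rewrite /witness_rows.
rewrite !decK /=.
rewrite -/(rows (adj (edges G))) /nws_check.
have -> : count id (flatten (chosen_matrix (rows (adj (edges G))) (dec u))) = c.
  rewrite /chosen_matrix size_rows.
  rewrite (count_flatten_mkseq (Defs.order G) (fun i j =>
    nth false (nth [::] (rows (adj (edges G))) i) j &&
    nth false (nth [::] (dec u) i) j)).
  by apply: eq_card => p; rewrite !inE nth_rows.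
rewrite size_rows !scaled_leqE /= !bval_enc_nat muln1 leq_budget //.
have -> : (c%:Z <= edge_bound I)%R = ~~ (edge_bound I < 0)%R && (c <= `|edge_bound I|).
  by rewrite -leNgt; lia.
split=> [[/and4P[h1 h2 h3 /allP h4]]|[/andP[h1 h2] h3 h4]].
  split=> //; first by rewrite h1.
  by move=> C hC; apply: h4; apply: map_f.
congr [:: _]; rewrite h1 h2 h3 /=; apply/allP => _ /mapP[C hC ->]; exact: h4.
Qed.

Lemma in_NP_restrict (P : problem) D : in_NP P -> in_NP (restrict (P := P) D).
Proof.
by move=> [V [p [hV hp]]]; exists V, p; split=> // I [vI _]; apply: hp.
Qed.

Lemma nws_in_NP : in_NP unweighted_connectivity_nws.
Proof.
(* The identity is enough as size bound: the certificate is a matrix of the same format as the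
   encoded graph, which is part of the instance. *)
exists nws_verifier, 'X%R; split=> [|I b0]; first exact: polytime_nws_verifier.
rewrite hornerX /=; set G := nws_graph I.
split=> [[E' [sE lE bE cE]]|[u [_ /(nws_verifierP _ b0)]]].
  have E2 e : e \in E' -> #|e| = 2 by move/(subsetP sE); apply: card_edge.
  (* Only entries above the diagonal are set, so that no edge is counted twice. *)
  pose a (i j : vertex G) := (i < j) && adj E' i j.
  exists (enc_seq (rows a)); split.
    rewrite /enc_unweighted_nws {2}/enc_seq /= size_cat size_enc_word.
    rewrite /enc_graph -/(rows _) !size_enc_rows -/G.
    by move: (_ * _) (size _) => k k'; lia.
  apply/(nws_verifierP _ b0); rewrite decK -/G.
  set c := #|_|.
  have lec : c <= #|E'|.
    have inj : {in [set p : vertex G * vertex G | adj (edges G) p.1 p.2 &&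
        nth false (nth [::] (rows a) p.1) p.2] &, injective (fun p => [set p.1; p.2])}.
      move=> [i j] [i' j']; rewrite !inE !nth_rows /a /=.
      move=> /and3P[_ ij _] /and3P[_ ij' _] eq.
      by case: (eq_set2 eq) => -[ei ej]; subst; [ | lia].
    rewrite /c -(card_in_imset inj).
    apply: subset_leq_card; apply/subsetP => e /imsetP[[i j]].
    by rewrite inE nth_rows /= => /and3P[_ _ ij] ->.
  split.
  - by apply: le_trans lE; rewrite lez_nat.
  - by apply: le_trans bE; rewrite sumr_const ler_nat.
  - move=> C hC; apply/(connected_wordP (E := E')); last exact: cE.
    move=> i j; rewrite !nth_chosen_matrix !nth_rows /a.
    have symE x y : adj E' x y = adj E' y x by rewrite /adj setUC.
    have sub x y : adj E' x y -> adj (edges G) x y by apply: (subsetP sE).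
    case: (ltngtP i j) => [ij|ij|/val_inj <-]; rewrite ?andbF ?orbF /=.
    + by apply/idP/andP => [h|[]//]; split=> //; apply: sub.
    + by rewrite symE; apply/idP/andP => [h|[]//]; split=> //; apply: sub.
    + by apply/negP => /E2; rewrite setUid cards1.
set c := #|_| => -[lc bc conn].
pose P := [set p : vertex G * vertex G | adj (edges G) p.1 p.2 &&
        nth false (nth [::] (dec u) p.1) p.2].
(* An edge may be marked in both orders; the image then has fewer than [c] elements, which is the
   harmless direction. *)
exists [set [set p.1; p.2] | p in P].
have lec : #|[set [set p.1; p.2] | p in P]| <= c by apply: leq_imset_card.
split.
- by apply/subsetP => e /imsetP[p]; rewrite inE => /andP[h _] ->.
- by apply: le_trans lc; rewrite lez_nat.
- by apply: le_trans bc; rewrite sumr_const ler_nat.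
- move=> C /conn; apply: (iffLR (connected_wordP _ _)) => i j.
  rewrite !nth_chosen_matrix.
  apply/imsetP/orP => [[[i' j']]|[h|h]].
  + rewrite inE /= => h eq.
    by case: (eq_set2 eq) => -[-> ->]; [left | right].
  + by exists (i, j) => //; rewrite inE.
  + by exists (j, i) => /=; rewrite ?inE // setUC.
Qed.

(** * Hamiltonian cycles and communities *)

Lemma exists_third (T : finType) (x y : T) :
  2 < #|T| -> exists2 z, z != x & z != y.
Proof.
move=> T3; have /subsetPn[z _] : ~~ ([set: T] \subset [set x; y]).
  apply/negP => /subset_leq_card; rewrite cardsT cards2.
  by case: (_ != _); lia.
by rewrite !inE negb_or => /andP[zx zy]; exists z.
Qed.

Section CycleFromConnectivity.

Variables (T : finType) (E : {set {set T}}).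
Hypothesis T3 : 2 < #|T|.
Hypothesis E2 : forall e, e \in E -> #|e| = 2.
Hypothesis leE : #|E| <= #|T|.
Hypothesis conn : forall v, induced_connected E [set~ v].

Let nb x := [set y | adj E x y].

Let adjC x y : adj E x y = adj E y x.
Proof. by rewrite /adj setUC. Qed.

Let adj_neq x y : adj E x y -> x != y.
Proof. by move=> h; apply/eqP => e; have := E2 h; rewrite e setUid cards1. Qed.

(** A path from [x] to a third vertex that avoids [u] exists, and its first step is the required
    neighbour. *)
Let nb_avoid x u : u != x -> exists2 y, adj E x y & y != u.
Proof.
move=> ux; have [w wx wu] := exists_third x u T3.
have [_ /(_ x w)] := conn u; rewrite !inE eq_sym ux wu => /(_ isT isT).
case/connectP=> -[|y p] /=; first by move=> _ e; rewrite e eqxx in wx.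
by rewrite /induced_adj !inE => /andP[/and3P[_ yu xy] _] _; exists y.
Qed.

Let nb_geq2 x : exists y z, [/\ adj E x y, adj E x z & y != z].
Proof.
have [u ux _] := exists_third x x T3.
have [y xy _] := nb_avoid ux.
have yx : y != x by rewrite eq_sym adj_neq.
by have [z xz zy] := nb_avoid yx; exists y, z; rewrite eq_sym.
Qed.

(** Double counting of incidences: the map from [y] to the edge {x, y} embeds the neighbours of [x]
    into the edges at [x], and each edge has two ends. *)
Let sum_nb : \sum_x #|nb x| <= 2 * #|E|.
Proof.
have -> : 2 * #|E| = \sum_(e in E) #|e|.
  by rewrite (eq_bigr (fun _ => 2)) ?sum_nat_const 1?mulnC.
under [X in _ <= X]eq_bigr => e _ do rewrite -sum1_card big_mkcond.
rewrite exchange_big /=; apply: leq_sum => x _.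
rewrite -big_mkcondr sum1_card /=.
have inj : {in nb x &, injective (fun y => [set x; y])}.
  by move=> y y' _ _ /eq_set2[[]|[<- ->]].
rewrite -(card_in_imset inj); apply: subset_leq_card; apply/subsetP => e /imsetP[y].
by rewrite inE => xy ->; rewrite unfold_in /= set21 andbT.
Qed.

Let card_nb x : #|nb x| = 2.
Proof.
have ge2 y : 2 <= #|nb y|.
  have [a [b [ya yb ab]]] := nb_geq2 y.
  have <- : #|[set a; b]| = 2 by rewrite cards2 ab.
  by apply: subset_leq_card; rewrite subUset !sub1set !inE ya yb.
have [N eN] : exists N, N = #|T| by exists #|T|.
have N3 : 2 < N by rewrite eN.
have : \sum_y #|nb y| <= 2 * N.
  by apply: leq_trans sum_nb _; rewrite leq_mul2l eN leE.
rewrite (bigD1 x) //= => le.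
have : 2 * N.-1 <= \sum_(y | y != x) #|nb y|.
  rewrite mulnC eN -(cardC1 x) -sum_nat_const; exact: leq_sum.
by have := ge2 x; lia.
Qed.

Let nb_sub (A : {set T}) w : 2 <= #|A| -> A \subset nb w -> nb w = A.
Proof.
by move=> A2 sA; apply/esym/eqP; rewrite eqEcard sA card_nb.
Qed.

Let nb_pair w a b : a != b -> adj E w a -> adj E w b -> nb w = [set a; b].
Proof.
move=> ab wa wb; apply: nb_sub; first by rewrite cards2 ab.
by rewrite subUset !sub1set !inE wa wb.
Qed.

(** In a simple path with as many vertices as possible, a neighbour of the head outside the path
    would prolong it. A vertex between two of its neighbours shows that at least 3 vertices are
    possible. *)
Let longest_path : exists s, [/\ 2 < size s, uniq s, sorted (adj E) s &
  forall x, adj E (head x s) x -> x \in s].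
Proof.
pose P k := [exists t : k.-tuple T, uniq t && sorted (adj E) t].
have P3 : P 3.
  have [x _ _] : exists2 z : T, true & true.
    by case/card_gt0P: (ltnW (ltnW T3)) => x _; exists x.
  have [y [z [xy xz yz]]] := nb_geq2 x.
  apply/existsP; exists [tuple y; x; z]; rewrite /= !inE negb_or yz.
  by rewrite (adjC y) xy xz (adj_neq xz) andbT eq_sym (adj_neq xy).
have Pmax k : P k -> k <= #|T|.
  by case/existsP=> t /andP[/card_uniqP ut _]; rewrite -(size_tuple t) -ut max_card.
case: (ex_maxnP (ex_intro P 3 P3) Pmax) => k /existsP[t /andP[ut st]] max.
have sk := size_tuple t.
exists t; split=> //; first by rewrite sk; apply: max.
move=> x hx; apply: contraT => xt; suff /max : P k.+1 by rewrite ltnn.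
apply/existsP; exists [tuple of x :: t].
rewrite /= xt ut /=; move: hx st; case: (tval t) => //= y s.
by rewrite adjC => -> ->.
Qed.

(** The second neighbour [z] of the head of a longest path lies on the path and can only be its last
    vertex, so the path closes to a cycle. A cycle in a 2-regular graph is closed under adjacency,
    hence covers everything by connectivity. *)
Lemma cycle_of_connectivity :
  exists s, [/\ 2 < size s, ucycle (adj E) s & forall x, x \in s].
Proof.
have [s [s3 us ss hs]] := longest_path.
have uc : ucycle (adj E) s.
  case: s s3 us ss hs => [|x [|y q]] //= s3 us /andP[xy pq] hs.
  have [z xz zy] : exists2 z, adj E x z & z != y.
    by apply: nb_avoid; rewrite eq_sym adj_neq.
  have := hs z xz; rewrite !inE eq_sym (negbTE (adj_neq xz)) (negbTE zy) /= => zq.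
  case/splitPr: zq us pq s3 => q1 [|w q2] us pq s3.
    by rewrite /ucycle /= us andbT rcons_path xy pq last_cat /= adjC.
  (* An inner vertex [z] would have three distinct neighbours: its predecessor [a], its successor
     [w] and the head [x]. *)
  exfalso; move: pq; rewrite cat_path /= => /and4P[_ az zw _].
  set a := last y q1 in az; rewrite adjC in az.
  have ain : a \in y :: q1 by exact: mem_last.
  have uniq3 : [/\ a != w, a != x & w != x].
    have : uniq (x :: (y :: q1) ++ z :: w :: q2) by [].
    rewrite cons_uniq mem_cat negb_or cat_uniq => /and4P[/andP[xa xr] _ /hasPn dis _].
    move: xr; rewrite !inE !negb_or => /and3P[_ xw _].
    split; last by rewrite eq_sym.
      apply/eqP => e; have /dis/negP : w \in z :: w :: q2 by rewrite !inE eqxx orbT.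
      by apply; rewrite -e; apply: ain.
    by apply: contraNneq xa => <-.
  case: uniq3 => aw ax wx.
  have := nb_pair aw az zw => /setP/(_ x); rewrite !inE adjC xz.
  by rewrite eq_sym (negbTE ax) eq_sym (negbTE wx).
(* After a rotation to [w], the successor and the predecessor of [w] on the cycle are two distinct
   neighbours, hence all of them. *)
have closed_s w x : w \in s -> adj E w x -> x \in s.
  move=> ws wx; case: (rot_to ws) => i p er.
  have := s3; rewrite -(size_rot i) er => p3.
  have := us; rewrite -(rot_uniq i) er => up.
  case/andP: (uc) => + _; rewrite -(rot_cycle i) er.
  case: p er p3 up => [|a p] er // p3 up /=; rewrite rcons_path /= => /and3P[wa _ bw].
  have ab : a != last a p.
    case: p p3 up {er bw} => // b p _ /= /and3P[_ + _].
    by apply: contraNneq => ->; apply: mem_last.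
  rewrite adjC in bw.
  have : x \in nb w by rewrite inE.
  rewrite (nb_pair ab wa bw) -(mem_rot i) er => /set2P[]->.
    by rewrite !inE eqxx orbT.
  by rewrite inE mem_last orbT.
exists s; split=> // y.
case: s s3 {us ss hs uc} closed_s => // x s _ closed_s.
(* The hypothesis connects only complements of vertices, so a vertex [v] different from both ends is
   removed to obtain a path from [x] to [y]. *)
have [v vx vy] := exists_third x y T3.
have [_ /(_ x y)] := conn v; rewrite !inE eq_sym vx eq_sym vy => /(_ isT isT).
case/connectP=> p + ->; have := mem_head x s.
have : forall u, u \in x :: s -> path (induced_adj E [set~ v]) u p ->
  last u p \in x :: s; last exact.
elim: p => //= z p IH u us /andP[/and3P[_ _ uz] pz].
by apply: IH pz; exact: closed_s us uz.
Qed.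

End CycleFromConnectivity.

(** The edges of the cycle suffice: rotated to start at [v], the cycle without [v] is a path through
    all other vertices. *)
Lemma connectivity_of_cycle (T : finType) (E : {set {set T}}) (s : seq T) :
  2 < size s -> ucycle (adj E) s -> (forall x, x \in s) ->
  exists E' : {set {set T}}, [/\ E' \subset E, #|E'| <= #|T| &
    forall v, induced_connected E' [set~ v]].
Proof.
move=> s3 /andP[cs us] all_s; pose E' := [set [set x; next s x] | x : T].
exists E'; split.
- by apply/subsetP => e /imsetP[x _ ->]; apply: (next_cycle cs (all_s x)).
- exact: leq_imset_card.
move=> v; case: (rot_to (all_s v)) => i p er.
have := s3; rewrite -(size_rot i) er.
have := us; rewrite -(rot_uniq i) er.
have := cycle_next us; rewrite -(rot_cycle i) er.
have := all_s; case: p er => // y q er {}all_s /=.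
rewrite rcons_path => /and3P[_ pq _] /andP[vq uq] _.
have py : path (induced_adj E' [set~ v]) y q.
  apply: (sub_in_path (P := mem [set~ v])) pq.
    move=> a b /= av bv /eqP eb.
    by rewrite /induced_adj av bv /adj -eb; apply: imset_f.
  apply/allP => z zq; suff : z \in [set~ v] by [].
  by rewrite !inE; apply: contraNneq vq => <-.
rewrite induced_connectedP; exists y.
  by rewrite !inE; apply: contraNneq vq => <-; apply: mem_head.
move=> x; rewrite !inE => xv; apply: (path_connect py).
by have := all_s x; rewrite -(mem_rot i) er inE (negbTE xv).
Qed.

(** Any two vertices lie together in the complement of a third one. *)
Lemma components_pairwise (T : finType) :
  2 < #|T| -> hypergraph_components [seq [set~ v] | v <- enum T] = 1.
Proof.
move=> T3; rewrite /hypergraph_components; set e := fun x y => _.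
have eT x y : e x y.
  have [z zx zy] := exists_third x y T3.
  apply/hasP; exists [set~ z]; first by apply: map_f; rewrite mem_enum.
  by rewrite !inE eq_sym zx eq_sym.
have [x _ _] : exists2 z : T, true & true.
  by case/card_gt0P: (ltnW (ltnW T3)) => x _; exists x.
have ce : connect_sym e by move=> y z; rewrite !connect1.
rewrite -(n_comp_connect ce x); apply: eq_n_comp_r => y.
by rewrite !inE connect1.
Qed.

Lemma components_set0 (T : finType) :
  hypergraph_components [:: set0 : {set T}] = #|T|.
Proof.
rewrite /hypergraph_components; set e := fun x y => _.
apply: eq_card => x; rewrite !inE andbT; apply/eqP.
have /connectP[p + ->] := connect_root e x.
by case: p => //= y p; rewrite /e /= !inE.
Qed.

(** * The reduction *)

(** On fewer than 3 vertices the empty community leaves all n vertices as components, so the edge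
    bound 1 gives t = 1 - n + n = 1. The budget repeats the edge bound, which with unit weights adds
    no constraint; as the image of an integer it has denominator 1. *)
Definition nws_of_graph (G : graph) : unweighted_nws_instance :=
  if Defs.order G < 3 then @UnweightedNWS G [:: set0] 1 1%:Z%:~R%R
  else @UnweightedNWS G [seq [set~ v] | v <- enum (vertex G)]
         (Defs.order G)%:Z (Defs.order G)%:Z%:~R%R.

Lemma nws_graph_of_graph G : nws_graph (nws_of_graph G) = G.
Proof. by rewrite /nws_of_graph; case: ifP. Qed.

Lemma budget_of_graph G : (0 < budget (nws_of_graph G))%R.
Proof.
rewrite /nws_of_graph; case: (ltnP (Defs.order G) 3) => //= h.
by rewrite ltr0z; lia.
Qed.

Lemma nws_t_of_graph G : nws_t (nws_of_graph G) = 1%R.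
Proof.
rewrite /nws_t /nws_of_graph; case: ltnP => h /=.
  by rewrite components_set0 card_ord; lia.
by rewrite components_pairwise ?card_ord //; lia.
Qed.

Lemma nws_of_graphP G :
  (exists s : seq (vertex G), is_hamiltonian_cycle s) <->
  @yes unweighted_connectivity_nws (nws_of_graph G).
Proof.
rewrite /yes /= /nws_of_graph; case: ltnP => h /=.
  split=> [[s [s3 /andP[_ us] _]]|[E' [_ _ _ /(_ set0)]]].
    move/card_uniqP: us => us; have := max_card (mem s).
    by rewrite us card_ord => /(leq_trans s3); rewrite leqNgt h.
  by rewrite mem_head => /(_ isT) [/eqP].
split=> [[s [s3 cs all_s]]|[E' [sE lE _ conn]]].
  have [E' [sE lE conn]] := connectivity_of_cycle s3 cs all_s.
  rewrite card_ord in lE.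
  exists E'; split=> //; last by move=> _ /mapP[v _ ->].
  by rewrite sumr_const -pmulrn ler_nat.
have [|e eE||v|s [s3 cs all_s]] := @cycle_of_connectivity (vertex G) E'.
- by rewrite card_ord.
- by apply: card_edge; apply: (subsetP sE).
- by rewrite card_ord -lez_nat.
- by apply: conn; apply: map_f; rewrite mem_enum.
exists s; split=> //; move: cs; rewrite /ucycle => /andP[cs ->]; rewrite andbT.
by apply: sub_cycle cs => x y; apply: (subsetP sE).
Qed.

Lemma mkseq_ord (T : Type) n (f : nat -> T) :
  mkseq f n = [seq f (val i) | i <- enum 'I_n].
Proof. by rewrite /mkseq -val_enum_ord -map_comp. Qed.

(** This makes the code of the new instance a function of the code of the graph alone, as
    composition with the given reduction requires. *)
Lemma enc_nws_of_graph G :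
  enc_unweighted_nws (nws_of_graph G) = reduction_word (enc_graph G).
Proof.
have es : size (dec (enc_graph G)) = Defs.order G.
  by rewrite decK size_map size_enum_ord.
rewrite /reduction_word es /nws_of_graph.
case: ltnP => h; rewrite /enc_unweighted_nws /=.
  rewrite /no_instance_word /enc_rat numq_int denq_int.
  congr (enc_seq [:: _; enc_seq [:: _]; _; enc_seq _]).
  by rewrite mkseq_ord; apply: eq_map => i; rewrite inE.
rewrite /cycle_instance_word /enc_rat numq_int denq_int.
congr (enc_seq [:: _; enc_seq _; _; enc_seq _]).
rewrite mkseq_ord -map_comp; apply: eq_map => i /=.
by rewrite mkseq_ord; apply: eq_map => j; rewrite !inE.
Qed.

Lemma eq_polytime f g : f =1 g -> polytime f -> polytime g.
Proof.
by move=> e [M [p h]]; exists M, p => x; rewrite -e; apply: h.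
Qed.

(** Hardness passes to weaker restrictions because the reduction still produces valid instances;
    thus the case t = 1 settles the general one. *)
Lemma NP_hard_restrictW (P : problem) (D D' : instance P -> Prop) :
  (forall I, D I -> D' I) -> NP_hard (restrict D) -> NP_hard (restrict D').
Proof.
move=> sub hD L /hD [f [pf hf]]; exists f; split=> // x.
by have [[vx /sub Dx] yx] := hf x.
Qed.

Theorem theorem21 (Pi : graph_class) :
  NP_hard (restrict (P := hamiltonian_cycle) (fun G : graph => Pi G)) ->
  NP_complete (restrict (P := unweighted_connectivity_nws)
    (fun I : unweighted_nws_instance => Pi (nws_graph I))) /\
  NP_complete (restrict (P := unweighted_connectivity_nws)
    (fun I : unweighted_nws_instance =>
       Pi (nws_graph I) /\ nws_t I = 1%R)).
Proof.
move=> hardPi.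
have hard : NP_hard (restrict (P := unweighted_connectivity_nws)
    (fun I : unweighted_nws_instance => Pi (nws_graph I) /\ nws_t I = 1%R)).
  move=> L /hardPi [f [pf hf]]; exists (fun x => nws_of_graph (f x)); split.
    apply: eq_polytime (polytime_comp pf polytime_reduction_word) => x.
    by rewrite /= enc_nws_of_graph.
  move=> x; have [[_ Px] ->] := hf x; split; last exact: nws_of_graphP.
  split; first exact: budget_of_graph.
  by rewrite nws_graph_of_graph nws_t_of_graph.
split; split; try exact: in_NP_restrict nws_in_NP; last exact: hard.
by apply: NP_hard_restrictW hard => I [].
Qed.
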